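(* For every integer $m\geq 1$ and every integer $\ell$ with $1\le \ell\le m+1$, the subgraph of the $(2m+1)$-dimensional hypercube $Q_{2m+1}$ induced by the middle $2\ell$ levels, i.e., by all bitstrings of length $2m+1$ with at least $m+1-\ell$ and at most $m+\ell$ entries equal to $1$, has a Hamilton cycle.
   Context: The $n$-dimensional hypercube $Q_n$ is the graph whose vertices are all $\{0,1\}$-strings of length $n$, two strings being adjacent if and only if they differ in exactly one position. Level $k$ of $Q_n$ ($0\le k\le n$) is the set of all bitstrings of length $n$ with exactly $k$ entries equal to $1$. *)

(* Defs.v *)
From mathcomp Require Import all_boot.
Set Implicit Arguments. Unset Strict Implicit. Unset Printing Implicit Defensive.

Definition bitstring (n : nat) := {ffun 'I_n -> bool}.

Definition weight n (x : bitstring n) : nat := #|[set i | x i]|.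

Definition qadj n : rel (bitstring n) :=
  fun x y => #|[set i | x i != y i]| == 1.

Definition hamilton_cycle (T : finType) (e : rel T) (S : {set T}) (c : seq T) :=
  [/\ uniq c, 3 <= size c, c =i S & cycle e c].

Definition levels n (lo hi : nat) : {set bitstring n} :=
  [set x | lo <= weight x <= hi].

(* Main.v *)
Require Import Defs.
From mathcomp Require Import all_boot.
From mathcomp Require Import zify.

(* Call a bit of a bitstring unmatched if it stays so when 1 and 0 are read as
   opening and closing parentheses; the unmatched bits are then 0...01...1, and
   flipping the rightmost unmatched 0 again and again traverses a symmetric chain
   (Greene-Kleitman). Let R be a perfect matching of the middle 2l levels that
   pairs neighbours on these chains, and M one that instead splits or joins the
   Dyck words between the unmatched bits. The union of M and R is a disjoint
   union of even cycles. Exchanging edges along vertex-disjoint 4-cycles (for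
   l > 1), respectively along 9-vertex configurations built on 6-cycles (for
   l = 1), merges the cycles they touch: every cycle is balanced with respect to
   the bipartition, which rules out every other outcome of the exchange. It then
   remains to see that the exchanges connect all the cycles, which is a statement
   on Dyck words: rotations and leaf moves act transitively on the words of a
   given length. *)

Set Implicit Arguments. Unset Strict Implicit. Unset Printing Implicit Defensive.

(** * Perfect matchings whose union is a Hamilton cycle *)

Section Matchings.

Variables (T : finType) (e : rel T) (S : {set T}) (c : T -> bool).
Hypothesis e_sym : symmetric e.
Hypothesis e_color : forall x y, e x y -> c y = ~~ c x.

Definition perfect (f : T -> T) :=
  involutive f /\ {in S, forall x, (f x \in S) && e x (f x)}.

Definition union_rel (M R : T -> T) (x y : T) : bool :=
  (y == M x) || (y == R x).
Arguments union_rel M R x y /.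

Definition linked (M R : T -> T) := connect (union_rel M R).

(** The exchange must work for all matchings that agree with [M0] and [R0] on [D], and it changes
    them on [D] only, so that exchanges on disjoint sets can be carried out one after another. *)
Definition surgery (M0 R0 : T -> T) (D : {set T}) (a b : T) :=
  forall M R, perfect M -> perfect R ->
    {in D, M =1 M0} -> {in D, R =1 R0} ->
  exists M' R', [/\ perfect M' /\ perfect R',
    {in ~: D, M' =1 M}, {in ~: D, R' =1 R},
    subrel (linked M R) (linked M' R') & linked M' R' a b].

Lemma perfect_color f x : perfect f -> x \in S -> c (f x) = ~~ c x.
Proof. by case=> _ Sf xS; apply: e_color; case/andP: (Sf x xS). Qed.

Lemma linked_sym M R : involutive M -> involutive R ->
  connect_sym (union_rel M R).
Proof.
move=> MK RK; apply: sym_connect_sym => x y /=.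
by rewrite (eq_sym y (M x)) (eq_sym y (R x)) (can2_eq MK MK) (can2_eq RK RK).
Qed.

Lemma linkedM M R x : linked M R x (M x).
Proof. by apply: connect1; rewrite /= eqxx. Qed.

Lemma linkedR M R x : linked M R x (R x).
Proof. by apply: connect1; rewrite /= eqxx orbT. Qed.

Lemma perfect_mem f x : perfect f -> (f x \in S) = (x \in S).
Proof.
case=> fK fS; apply/idP/idP => [fxS | /fS/andP[]//].
by rewrite -[x]fK; case/andP: (fS _ fxS).
Qed.

(** [f] sends each colour class of [A] injectively into the other. *)
Lemma balanced f (A : {set T}) : perfect f -> A \subset S ->
  {in A, forall x, f x \in A} ->
  #|[set x in A | c x]| = #|[set x in A | ~~ c x]|.
Proof.
move=> pf AS fA.
have finj : injective f by apply: can_inj (proj1 pf).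
apply/eqP; rewrite eqn_leq; apply/andP.
split; rewrite -(card_imset _ finj);
  apply/subset_leq_card/subsetP => y /imsetP[x];
  rewrite !inE => /andP[xA cx] ->; rewrite fA // (perfect_color pf) ?cx //;
  exact: subsetP AS x xA.
Qed.

(* If the edge at x were a bridge, the component A of x would be balanced
   with respect to the colouring (being closed under f), and so would A minus
   one vertex (being closed under g), which is absurd. *)
Lemma no_bridge f g (A : {set T}) x : perfect f -> perfect g ->
  A \subset S -> {in A, forall y, f y \in A} ->
  x \in A -> g x \notin A ->
  {in A, forall y, y != x -> g y \in A} -> False.
Proof.
move=> pf pg AS fA xA gxA gA.
have gK := proj1 pg.
have e1 := balanced pf AS fA.
have AxS : A :\ x \subset S by apply: subset_trans (subD1set _ _) AS.
have gAx : {in A :\ x, forall y, g y \in A :\ x}.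
  move=> y; rewrite !inE => /andP[yx yA]; rewrite gA // andbT.
  by apply: contraNneq gxA => <-; rewrite gK.
have e2 := balanced pg AxS gAx.
have c1 : #|[set y in A | c y]| = c x + #|[set y in A :\ x | c y]|.
  by rewrite (cardsD1 x) !inE xA; congr (_ + _); apply: eq_card => y;
    rewrite !inE andbA.
have c2 : #|[set y in A | ~~ c y]| = ~~ c x + #|[set y in A :\ x | ~~ c y]|.
  by rewrite (cardsD1 x) !inE xA; congr (_ + _); apply: eq_card => y;
    rewrite !inE andbA.
by move: e1; rewrite c1 c2 e2 => /addIn; case: (c x).
Qed.

Lemma linked_sub M R M' R' : perfect M' -> perfect R' ->
  (forall x, linked M' R' x (M x)) -> (forall x, linked M' R' x (R x)) ->
  subrel (linked M R) (linked M' R').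
Proof.
move=> pM pR hM hR; apply: connect_sub => x y /= /orP[] /eqP->; [exact: hM|exact: hR].
Qed.

Lemma linked_in M R x y : perfect M -> perfect R -> linked M R x y ->
  (x \in S) = (y \in S).
Proof.
move=> pM pR /connectP[p pp ->]; elim: p x pp => //= a p IH x /andP[/orP[]/eqP->];
  by move/IH => <-; rewrite perfect_mem.
Qed.

(** * Exchange along a 4-cycle *)

Definition swap4 (R : T -> T) (x u : T) : T -> T := fun t =>
  if t == x then u else if t == u then x else
  if t == R x then R u else if t == R u then R x else R t.

Lemma perfect_irr f x : perfect f -> x \in S -> f x != x.
Proof.
move=> pf xS; apply/eqP => fx; have := perfect_color pf xS.
by rewrite fx; case: (c x).
Qed.

(** If [x] and [u] lie on different cycles, each cycle stays connected without its edge x-[R x] or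
    u-[R u], by [no_bridge]; the other two edges of the 4-cycle then join them. *)
Lemma surgery4 M0 R0 x u : x \in S -> u \in S -> e x u -> e (R0 x) (R0 u) ->
  surgery M0 R0 [set x; u; R0 x; R0 u] x u.
Proof.
move=> xS uS exu eRR M R pM pR _ eR.
have Rx : R x = R0 x by apply: eR; rewrite !inE eqxx.
have Ru : R u = R0 u by apply: eR; rewrite !inE eqxx ?orbT.
case: (boolP (linked M R x u)) => [xu | nxu].
  by exists M, R; split.
have RK := proj1 pR; have MK := proj1 pM.
have symL := linked_sym MK RK.
have cu : c u = ~~ c x by apply: e_color.
have nux : u != x by apply/eqP => ux; move: cu; rewrite ux; case: (c x).
have RxS : R x \in S by rewrite perfect_mem.
have RuS : R u \in S by rewrite perfect_mem.
have cRx := perfect_color pR xS; have cRu := perfect_color pR uS.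
have Rxx := perfect_irr pR xS; have Ruu := perfect_irr pR uS.
have RxRu : R u != R x by rewrite (can_eq RK).
have Rxu : R x != u.
  by apply: contraNneq nxu => <-; apply: linkedR.
have Rux : R u != x.
  by apply: contraNneq nxu => <-; rewrite /linked symL; apply: linkedR.
have swE : [/\ swap4 R x u x = u, swap4 R x u u = x,
    swap4 R x u (R x) = R u & swap4 R x u (R u) = R x].
  rewrite /swap4 !eqxx (negbTE nux) (negbTE Rxx) (negbTE Rxu) (negbTE Rux).
  by rewrite (negbTE Ruu) (negbTE RxRu).
have swO t : t \notin [set x; u; R x; R u] -> swap4 R x u t = R t.
  rewrite !inE !negb_or /swap4 => /andP[/andP[/andP[]]].
  by do 4!move/negbTE=> ->.
case: swE => sx su sRx sRu.
have swD t : t \notin [set x; u; R x; R u] -> R t \notin [set x; u; R x; R u].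
  rewrite !inE !negb_or => /andP[/andP[/andP[h1 h2] h3] h4].
  by rewrite !(can_eq RK) h1 h2 !(can2_eq RK RK) h3 h4.
have pR' : perfect (swap4 R x u).
  split=> [t | t tS].
    case: (boolP (t \in [set x; u; R x; R u])) => [|tD].
      by rewrite !inE -!orbA => /or4P[] /eqP->; rewrite ?(sx, su, sRx, sRu).
    by rewrite (swO t tD) swO ?RK // swD.
  case: (boolP (t \in [set x; u; R x; R u])) => [|tD].
    rewrite !inE -!orbA => /or4P[] /eqP->; rewrite ?(sx, su, sRx, sRu).
    - by rewrite uS.
    - by rewrite xS e_sym.
    - by rewrite RuS Rx Ru.
    - by rewrite RxS e_sym Rx Ru.
  by rewrite (swO t tD); case: pR => _; apply.
pose r1 := [rel a b | (b == M a) ||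
   ((b == R a) && (a \notin [set x; u; R x; R u]))].
have r1s : connect_sym r1.
  apply: sym_connect_sym => a b /=.
  rewrite (eq_sym b (M a)) (can2_eq MK MK) (eq_sym a (M b)) (eq_sym (M b) a).
  congr (_ || _); apply/andP/andP => -[/eqP-> aD]; split; rewrite ?RK //; exact: swD.
have r1L : subrel (connect r1) (linked M R).
  apply: connect_sub => a b /= /orP[/eqP->|/andP[/eqP-> _]].
    exact: linkedM.
  exact: linkedR.
have r1L' : subrel (connect r1) (linked M (swap4 R x u)).
  apply: connect_sub => a b /= /orP[/eqP->|/andP[/eqP-> aD]].
    exact: linkedM.
  by rewrite -swO //; apply: linkedR.
(* Stated for [a] and [b] to serve both deleted edges. If [R a] were not reached without them, [a]
   would be the only vertex of its component with an [R]-edge leaving it. *)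
have bridge a b : a \in S -> ~~ linked M R a b ->
    (forall t, t \in [set a; b; R a; R b] = (t \in [set x; u; R x; R u])) ->
    connect r1 a (R a).
  move=> aS nab dD; apply/negPn/negP => nRa.
  pose A := [set t | connect r1 a t].
  have inA t : t \in A -> t != a -> t \notin [set x; u; R x; R u].
    rewrite inE => art ta; rewrite -dD !inE !negb_or ta /=.
    apply/andP; split; first (apply/andP; split).
    - by apply: contraNneq nab => <-; apply: r1L.
    - by apply: contraNneq nRa => <-.
    - apply: contraNneq nab => tb; apply: (connect_trans (r1L _ _ art)).
      by rewrite tb symL; apply: linkedR.
  apply: (@no_bridge M R A a pM pR).
  - by apply/subsetP => t; rewrite inE => /r1L /(linked_in pM pR) <-.
  - move=> t; rewrite !inE => at_; apply: connect_trans at_ _.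
    by apply: connect1; rewrite /= eqxx.
  - by rewrite inE.
  - by rewrite inE.
  - move=> t tA ta; move: (tA); rewrite !inE => at_; apply: connect_trans at_ _.
    by apply: connect1; rewrite /= eqxx inA // orbT.
have xRx : connect r1 x (R x) by apply: (bridge x u).
have uRu : connect r1 u (R u).
  apply: (bridge u x) => //; first by rewrite /linked symL.
  by move=> t; rewrite !inE -!orbA; apply/or4P/or4P => -[] ->;
    rewrite ?orbT; [constructor 2|constructor 1|constructor 4|constructor 3
     |constructor 2|constructor 1|constructor 4|constructor 3].
have symL' := linked_sym MK (proj1 pR').
exists M, (swap4 R x u); split=> //.
- by move=> t; rewrite inE -Rx -Ru => /swO.
- apply: linked_sub => // t; first exact: linkedM.
  case: (boolP (t \in [set x; u; R x; R u])) => [|tD].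
    rewrite !inE -!orbA => /or4P[] /eqP->; rewrite ?RK.
    + exact: r1L'.
    + exact: r1L'.
    + by rewrite /linked symL'; apply: r1L'.
    + by rewrite /linked symL'; apply: r1L'.
  by rewrite -(swO t tD); apply: linkedR.
- by rewrite -{2}sx; apply: linkedR.
Qed.

(** * Exchange along a hexagon *)

Fixpoint pairing (l : seq (T * T)) (t : T) : T :=
  if l is (u, v) :: l' then
    if t == u then v else if t == v then u else pairing l' t
  else t.

Definition support (l : seq (T * T)) := flatten [seq [:: p.1; p.2] | p <- l].

Lemma pairing_out l t : t \notin support l -> pairing l t = t.
Proof.
elim: l => //= -[u v] l IH /=; rewrite !inE !negb_or => /and3P[/negbTE-> /negbTE-> ].
exact: IH.
Qed.

Lemma pairing_mem l t : (pairing l t \in support l) = (t \in support l).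
Proof.
elim: l => //= -[u v] l IH /=; rewrite !inE.
have [->|tu] := eqVneq t u; first by rewrite eqxx orbT.
have [->|tv] := eqVneq t v; first by rewrite eqxx orbT.
case: (boolP (t \in support l)) => tl; first by rewrite IH tl !orbT.
by rewrite pairing_out // (negbTE tu) (negbTE tv) (negbTE tl).
Qed.

Lemma pairingK l : uniq (support l) -> involutive (pairing l).
Proof.
elim: l => //= -[u v] l IH /=; rewrite inE negb_or => /and3P[/andP[uv ul] vl /IH{}IH] t.
have [->|tu] := eqVneq t u.
  by rewrite eqxx; case: eqVneq uv => [->|]; rewrite ?eqxx.
have [->|tv] := eqVneq t v; first by rewrite eqxx.
have [tl|tl] := boolP (t \in support l); last first.
  by rewrite (pairing_out tl) (negbTE tu) (negbTE tv) pairing_out.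
have := tl; rewrite -pairing_mem => ptl.
have [pu|_] := eqVneq (pairing l t) u; first by rewrite pu (negbTE ul) in ptl.
have [pv|_] := eqVneq (pairing l t) v; first by rewrite pv (negbTE vl) in ptl.
exact: IH.
Qed.

Lemma pairing_in l u v : uniq (support l) -> (u, v) \in l ->
  u \in support l /\ pairing l u = v.
Proof.
elim: l => //= -[u' v'] l IH /=; rewrite inE negb_or => /and3P[/andP[uv ul] vl /IH{}IH].
rewrite !inE => /predU1P[[-> ->]|/IH[ul' <-]]; first by rewrite eqxx.
rewrite ul' !orbT; case: eqVneq => [uu|_]; first by rewrite -uu ul' in ul.
by case: eqVneq => [uu|_] //; rewrite -uu ul' in vl.
Qed.

Definition patch (f : T -> T) l t := if t \in support l then pairing l t else f t.

Lemma perfect_patch f l : perfect f -> uniq (support l) ->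
  {in support l, forall t, f t \in support l} ->
  all (fun p => [&& p.1 \in S, p.2 \in S & e p.1 p.2]) l ->
  perfect (patch f l).
Proof.
move=> pf ul fl el; have fK := proj1 pf.
split=> [t | t tS]; rewrite /patch.
  have [tl|tl] := boolP (t \in support l); first by rewrite pairing_mem tl pairingK.
  have [ftl|_] := boolP (f t \in support l); last exact: fK.
  by have := fl _ ftl; rewrite fK (negbTE tl).
have [tl|tl] := boolP (t \in support l); last by case: pf => _; apply.
elim: l el tl {ul fl} => //= -[u v] l IH /= /andP[/and3P[uS vS euv] el].
rewrite !inE; have [->|tu] := eqVneq t u; first by rewrite vS.
have [->|tv] := eqVneq t v; first by rewrite uS e_sym.
exact: IH.
Qed.

(* The hexagon x b y d z a: the paths d-p-q-r-a, from x to z and from y to b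
   survive the removal of the edges x-a, y-b, z-d, and the edges d-y, b-x, z-a
   concatenate them.  The colours along d-p-q-r-a are exchanged. *)
Lemma surgery6 M0 R0 x y z a b d p q r :
  uniq [:: x; y; z; a; b; d; p; q; r] ->
  all (fun t => t \in S) [:: x; y; z; a; b; d; p; q; r] ->
  [/\ M0 x = a, M0 y = b, M0 d = p & M0 q = r] ->
  [/\ R0 z = d, R0 p = q & R0 r = a] -> [/\ e d y, e b x & e z a] ->
  surgery M0 R0 [set t in [:: x; y; z; a; b; d; p; q; r]] x y.
Proof.
move=> un /allP inS [M0x M0y M0d M0q] [R0z R0p R0r] [edy ebx eza] M R pM pR eM eR.
have MK := proj1 pM; have RK := proj1 pR.
have {}eM t : t \in [:: x; y; z; a; b; d; p; q; r] -> M t = M0 t.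
  by move=> h; apply: eM; rewrite inE.
have {}eR t : t \in [:: x; y; z; a; b; d; p; q; r] -> R t = R0 t.
  by move=> h; apply: eR; rewrite inE.
have Mx : M x = a by rewrite eM ?inE ?eqxx ?orbT.
have My : M y = b by rewrite eM ?inE ?eqxx ?orbT.
have Md : M d = p by rewrite eM ?inE ?eqxx ?orbT.
have Mq : M q = r by rewrite eM ?inE ?eqxx ?orbT.
have Rz : R z = d by rewrite eR ?inE ?eqxx ?orbT.
have Rp : R p = q by rewrite eR ?inE ?eqxx ?orbT.
have Rr : R r = a by rewrite eR ?inE ?eqxx ?orbT.
have Ma : M a = x by rewrite -Mx MK.
have Mb : M b = y by rewrite -My MK.
have Mp : M p = d by rewrite -Md MK.
have Mr : M r = q by rewrite -Mq MK.
have Rd : R d = z by rewrite -Rz RK.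
have Rq : R q = p by rewrite -Rp RK.
have Ra : R a = r by rewrite -Rr RK.
case: (boolP (linked M R x y)) => [xy|nxy]; first by exists M, R; split.
have symL := linked_sym MK RK.
(* At [d] an [R]-edge gives way to the [M]-edge d-y, at [a] an [M]-edge to the [R]-edge z-a; hence
   the four edges of the path between them change matching. *)
pose lM := [:: (p, q); (r, a); (d, y); (b, x)].
pose lR := [:: (z, a); (d, p); (q, r)].
have S9 t : t \in [:: x; y; z; a; b; d; p; q; r] -> t \in S by apply: inS.
have ulM : uniq (support lM).
  move: un; rewrite /= !inE !negb_or -!andbA.
  repeat (case/andP=> ?); move=> _.
  by repeat (apply/andP; split); rewrite // eq_sym.
have ulR : uniq (support lR).
  move: un; rewrite /= !inE !negb_or -!andbA.
  repeat (case/andP=> ?); move=> _.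
  by repeat (apply/andP; split); rewrite // eq_sym.
have eqr : e q r by rewrite -Mq; case: pM => _ /(_ q) /(_ (S9 q _)) /andP[]//; rewrite !inE eqxx !orbT.
have epq : e p q by rewrite -Rp; case: pR => _ /(_ p) /(_ (S9 p _)) /andP[]//; rewrite !inE eqxx !orbT.
have era : e r a by rewrite -Rr; case: pR => _ /(_ r) /(_ (S9 r _)) /andP[]//; rewrite !inE eqxx !orbT.
have edp : e d p by rewrite -Md; case: pM => _ /(_ d) /(_ (S9 d _)) /andP[]//; rewrite !inE eqxx !orbT.
have pM' : perfect (patch M lM).
  apply: perfect_patch => //.
    move=> t; rewrite !inE.
    by repeat (case/orP); move/eqP=> ->; rewrite ?(Mx,My,Md,Mq,Ma,Mb,Mp,Mr) eqxx ?orbT.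
  by rewrite /= epq era edy ebx !S9 ?inE ?eqxx ?orbT.
have pR' : perfect (patch R lR).
  apply: perfect_patch => //.
    move=> t; rewrite !inE.
    by repeat (case/orP); move/eqP=> ->; rewrite ?(Rz,Rp,Rr,Rd,Rq,Ra) eqxx ?orbT.
  by rewrite /= eza edp eqr !S9 ?inE ?eqxx ?orbT.
pose L' := linked (patch M lM) (patch R lR).
have symL' := linked_sym (proj1 pM') (proj1 pR').
have L'M u v : (u, v) \in lM -> L' u v.
  move=> uv; have [h <-] := pairing_in ulM uv.
  by have := linkedM (patch M lM) (patch R lR) u; rewrite {3}/patch h.
have L'R u v : (u, v) \in lR -> L' u v.
  move=> uv; have [h <-] := pairing_in ulR uv.
  by have := linkedR (patch M lM) (patch R lR) u; rewrite {3}/patch h.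
pose r1 := [rel s t | ((t == M s) && (s \notin [:: x; a; y; b])) ||
   ((t == R s) && (s \notin [:: z; d]))].
have M4 t : (M t \in [:: x; a; y; b]) = (t \in [:: x; a; y; b]).
  rewrite !inE !(can2_eq MK MK) Mx Ma My Mb.
  by rewrite [RHS]orbCA; congr (_ || (_ || _)); rewrite orbC.
have R2 t : (R t \in [:: z; d]) = (t \in [:: z; d]).
  by rewrite !inE !(can2_eq RK RK) Rz Rd orbC.
have r1s : connect_sym r1.
  apply: sym_connect_sym => s t /=; congr (_ || _);
  by apply/andP/andP => -[/eqP-> h]; rewrite ?MK ?RK ?M4 ?R2.
have r1L : subrel (connect r1) (linked M R).
  apply: connect_sub => s t /= /orP[] /andP[/eqP-> _].
    exact: linkedM.
  exact: linkedR.
have r1L' : subrel (connect r1) L'.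
  apply: connect_sub => s t /= /orP[] /andP[/eqP-> h].
    have [sl|sl] := boolP (s \in support lM); last first.
      by have := linkedM (patch M lM) (patch R lR) s; rewrite {3}/patch (negbTE sl).
    move: sl h; rewrite !inE; repeat (case/orP); move/eqP=> ->;
      rewrite ?eqxx ?orbT //= ?(Md, Mp, Mq, Mr) => _.
    + by rewrite /L' /linked symL'; apply: L'R; rewrite !inE !eqxx ?orbT.
    + by apply: L'R; rewrite !inE !eqxx ?orbT.
    + by rewrite /L' /linked symL'; apply: L'R; rewrite !inE !eqxx ?orbT.
    + by apply: L'R; rewrite !inE !eqxx ?orbT.
  have [sl|sl] := boolP (s \in support lR); last first.
    by have := linkedR (patch M lM) (patch R lR) s; rewrite {3}/patch (negbTE sl).
  move: sl h; rewrite !inE; repeat (case/orP); move/eqP=> ->;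
    rewrite ?eqxx ?orbT //= ?(Rr, Rp, Rq, Ra) => _.
  + by rewrite /L' /linked symL'; apply: L'M; rewrite !inE !eqxx ?orbT.
  + by apply: L'M; rewrite !inE !eqxx ?orbT.
  + by rewrite /L' /linked symL'; apply: L'M; rewrite !inE !eqxx ?orbT.
  + by apply: L'M; rewrite !inE !eqxx ?orbT.
have r1M t : t \notin [:: x; a; y; b] -> connect r1 t (M t).
  by move=> h; apply: connect1; rewrite /= eqxx h.
have r1R t : t \notin [:: z; d] -> connect r1 t (R t).
  by move=> h; apply: connect1; rewrite /= eqxx h orbT.
have da : connect r1 d a.
  move: un; rewrite /= !inE !negb_or -!andbA.
  repeat (case/andP=> ?); move=> _.
  apply: (@connect_trans _ _ p); first by rewrite -Md; apply: r1M;
    rewrite !inE !negb_or !(eq_sym d); apply/and4P.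
  apply: (@connect_trans _ _ q); first by rewrite -Rp; apply: r1R;
    rewrite !inE !negb_or !(eq_sym p); apply/andP.
  apply: (@connect_trans _ _ r); first by rewrite -Mq; apply: r1M;
    rewrite !inE !negb_or !(eq_sym q); apply/and4P.
  by rewrite -Rr; apply: r1R; rewrite !inE !negb_or !(eq_sym r); apply/andP.
have xa : linked M R x a by rewrite -Mx; apply: linkedM.
have xd : linked M R x d by rewrite /linked symL; apply: connect_trans (r1L _ _ da) _; rewrite symL.
have xz : linked M R x z by apply: connect_trans xd _; rewrite -Rd; apply: linkedR.
have yb : linked M R y b by rewrite -My; apply: linkedM.
have nx t : linked M R x t -> linked M R y t -> False.
  move=> xt yt; case/negP: nxy; apply: connect_trans xt _.
  by rewrite symL.
have notin4 t u1 u2 u3 u4 : t != u1 -> t != u2 -> t != u3 -> t != u4 ->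
    t \notin [:: u1; u2; u3; u4] by rewrite !inE !negb_or => -> -> -> ->.
have notin2 t u1 u2 : t != u1 -> t != u2 -> t \notin [:: u1; u2].
  by rewrite !inE !negb_or => -> ->.
have xS : x \in S by apply: S9; rewrite inE eqxx.
have yS : y \in S by apply: S9; rewrite !inE eqxx orbT.
have compS t0 : t0 \in S -> [set t | connect r1 t0 t] \subset S.
  by move=> t0S; apply/subsetP => t; rewrite inE => /r1L /(linked_in pM pR) <-.
have y_b : connect r1 y b.
  apply/negPn/negP => nb.
  apply: (@no_bridge R M [set t | connect r1 y t] y pR pM (compS y yS));
    rewrite ?inE ?My //.
  - move=> t; rewrite !inE => yt; apply: (connect_trans yt (r1R _ _)).
    by apply: notin2; apply/eqP => tE; rewrite tE in yt; apply: nx (r1L _ _ yt).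
  - move=> t; rewrite !inE => yt ty; apply: (connect_trans yt (r1M _ _)).
    apply: notin4 => //; apply/eqP => tE; rewrite tE in yt.
    + by apply: nx (r1L _ _ yt); apply: connect0.
    + exact: nx (r1L _ _ yt).
    + by rewrite yt in nb.
have x_z : connect r1 x z.
  apply/negPn/negP => nz.
  have xny t : connect r1 x t -> t != y.
    by move=> xt; apply/eqP => tE; rewrite tE in xt; case/negP: nxy; apply: r1L.
  have xnb t : connect r1 x t -> t != b.
    by move=> xt; apply/eqP => tE; rewrite tE in xt; apply: nx yb; apply: r1L.
  have xnz t : connect r1 x t -> t != z.
    by move=> xt; apply/eqP => tE; rewrite tE in xt; rewrite xt in nz.
  (* If [x] is joined to [d], and so to [a], only the edge d-z leaves its component; otherwise only
     the edge x-a does. Both contradict [no_bridge]. *)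
  have [xd1|xd1] := boolP (connect r1 x d).
    have xa1 := connect_trans xd1 da.
    apply: (@no_bridge M R [set t | connect r1 x t] d pM pR (compS x xS));
      rewrite ?inE ?Rd //.
    - move=> t; rewrite !inE => xt.
      have [->|tx] := eqVneq t x; first by rewrite Mx.
      have [->|ta] := eqVneq t a; first by rewrite Ma.
      by apply: (connect_trans xt (r1M _ _)); apply: notin4 => //; [apply: xny|apply: xnb].
    - move=> t; rewrite !inE => xt td; apply: (connect_trans xt (r1R _ _)).
      by apply: notin2 => //; apply: xnz.
  have xa1 : ~~ connect r1 x a.
    by apply: contra xd1 => xa1; apply: connect_trans xa1 _; rewrite r1s.
  apply: (@no_bridge R M [set t | connect r1 x t] x pR pM (compS x xS));
    rewrite ?inE ?Mx ?connect0 //.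
  - move=> t; rewrite !inE => xt; apply: (connect_trans xt (r1R _ _)).
    apply: notin2; first exact: xnz.
    by apply: contraNneq xd1 => <-.
  - move=> t; rewrite !inE => xt tx; apply: (connect_trans xt (r1M _ _)).
    apply: notin4 => //; [|exact: xny|exact: xnb].
    by apply: contraNneq xa1 => <-.
have L'za : L' z a by apply: L'R; rewrite !inE !eqxx.
have L'xa : L' x a by apply: connect_trans (r1L' _ _ x_z) L'za.
have L'zd : L' z d by apply: connect_trans L'za _; rewrite symL'; apply: r1L'.
have L'yb : L' y b by apply: r1L'.
have out9 t : t \in ~: [set t in [:: x; y; z; a; b; d; p; q; r]] ->
    (t \notin support lM) /\ (t \notin support lR).
  rewrite !inE !negb_or -?andbA; repeat (case/andP=> ?); move=> *.
  by split; repeat (apply/andP; split).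
exists (patch M lM), (patch R lR); split=> //.
- by move=> t /out9[h _]; rewrite /patch (negbTE h).
- by move=> t /out9[_ h]; rewrite /patch (negbTE h).
- apply: linked_sub => // t.
    have [|h] := boolP (t \in [:: x; a; y; b]); last by apply: r1L'; apply: r1M.
    rewrite !inE; repeat (case/orP); move/eqP=> ->; rewrite ?(Mx, Ma, My, Mb) //.
      by rewrite /linked symL'.
    by rewrite /linked symL'.
  have [|h] := boolP (t \in [:: z; d]); last by apply: r1L'; apply: r1R.
  by rewrite !inE; repeat (case/orP); move/eqP=> ->; rewrite ?(Rz, Rd) // /linked symL'.
- apply: (@connect_trans _ _ b).
    by rewrite symL'; apply: L'M; rewrite !inE !eqxx !orbT.
  by rewrite symL'.
Qed.

(** * Disjoint exchanges, and the cycle traced by two matchings *)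

Lemma iterate_surgery (I : eqType) (l : seq I) M0 R0 (D : I -> {set T})
    (a b : I -> T) :
  uniq l -> {in l, forall i, surgery M0 R0 (D i) (a i) (b i)} ->
  {in l &, forall i j, i != j -> [disjoint D i & D j]} ->
  perfect M0 -> perfect R0 ->
  exists M R, [/\ perfect M, perfect R, subrel (linked M0 R0) (linked M R)
    & {in l, forall i, linked M R (a i) (b i)}].
Proof.
move=> ul sl dl pM0 pR0.
(* The induction also records that nothing has changed outside the sets treated so far, so that the
   next exchange still finds [M0] and [R0] on its own set. *)
suff [M [R [pM pR sL lk _]]] : exists M R, [/\ perfect M, perfect R,
    subrel (linked M0 R0) (linked M R), {in l, forall i, linked M R (a i) (b i)} &
    forall t, (forall i, i \in l -> t \notin D i) -> (M t = M0 t) /\ (R t = R0 t)].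
  by exists M, R.
elim: l ul sl dl => [_ _ _|i l IH /= /andP[il ul] sl dl].
  by exists M0, R0; split.
have [||| M [R [pM pR sL lk ag]]] := IH.
- by [].
- by move=> j jl; apply: sl; rewrite inE jl orbT.
- by move=> j k jl kl; apply: dl; rewrite inE ?jl ?kl orbT.
have agD t : t \in D i -> (M t = M0 t) /\ (R t = R0 t).
  move=> tD; apply: ag => j jl; apply/negP => tDj.
  have ij : i != j by apply: contraNneq il => ->.
  have := dl i j (mem_head _ _) _ ij; rewrite inE jl orbT => /(_ isT).
  by move/disjointFr/(_ tD); rewrite tDj.
have [|| M' [R' [[pM' pR'] eM eR sL' lk']]] :=
    sl i (mem_head _ _) M R pM pR.
- by move=> t /agD[].
- by move=> t /agD[].
exists M', R'; split=> //.
- by move=> s t /sL /sL'.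
- by move=> j; rewrite inE => /predU1P[->|/lk/sL'].
move=> t tl; have tDi := tl i (mem_head _ _).
by rewrite eM ?inE // eR ?inE //; apply: ag => j jl; apply: tl; rewrite inE jl orbT.
Qed.

(** Following [M] and [R] alternately from [x0] visits a set closed under both, which is all of [S]
    by connectedness. Since [R (M x)] has the colour of [x], the orbit under this map and its image
    under [M] are disjoint, so no vertex repeats. *)
Lemma hamilton_of_matchings M R x0 : perfect M -> perfect R -> x0 \in S ->
  2 < #|S| -> {in S, forall x, linked M R x0 x} ->
  exists s, hamilton_cycle e S s.
Proof.
move=> pM pR x0S S3 conn.
have MK := proj1 pM; have RK := proj1 pR.
pose f x := R (M x).
have finj : injective f by move=> x y; rewrite /f => /(can_inj RK)/(can_inj MK).
have fS x : x \in S -> f x \in S by move=> xS; rewrite /f !perfect_mem.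
have fc x : x \in S -> c (f x) = c x.
  by move=> xS; rewrite /f !perfect_color ?negbK // perfect_mem.
pose o := orbit f x0.
have oS : {in o, forall x, (x \in S) && (c x == c x0)}.
  move=> x; rewrite -fconnect_orbit => /iter_findex <-.
  elim: (findex _ _ _) => [|k /andP[IH1 IH2]] /=; first by rewrite x0S eqxx.
  by rewrite fS // fc.
pose s := flatten [seq [:: z; M z] | z <- o].
have mem_s x : (x \in s) = (x \in o) || (M x \in o).
  apply/flatten_mapP/orP => [[z zo]|[xo|Mxo]].
  - by rewrite !inE => /orP[]/eqP->; rewrite ?MK zo; [left|right].
  - by exists x => //; rewrite mem_head.
  - by exists (M x) => //; rewrite !inE MK eqxx orbT.
have oclosed x : x \in o -> f x \in o.
  rewrite -!fconnect_orbit => h; apply: connect_trans h (fconnect1 _ _).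
have oclosedV x : x \in o -> M (R x) \in o.
  rewrite -!fconnect_orbit => h; apply: connect_trans h _.
  by rewrite fconnect_sym // -{2}[x]RK -[R x in X in fconnect _ _ X]MK;
    apply: (fconnect1 f).
have sM x : x \in s -> M x \in s by rewrite !mem_s MK orbC.
have sR x : x \in s -> R x \in s.
  rewrite !mem_s => /orP[xo|Mxo]; first by rewrite oclosedV ?orbT.
  by have := oclosed _ Mxo; rewrite /f MK => ->.
have x0s : x0 \in s by rewrite mem_s -fconnect_orbit connect0.
have s_last p x : x \in s -> path (union_rel M R) x p -> last x p \in s.
  elim: p x => //= y p IH x xs /andP[/orP[]/eqP-> yp]; apply: IH yp.
    exact: sM.
  exact: sR.
have s_all x : (x \in s) = (x \in S).
  apply/idP/idP => [|/conn/connectP[p pp ->]]; last exact: s_last.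
  rewrite mem_s => /orP[|] /oS /andP[]; first by [].
  by rewrite perfect_mem.
have s_perm l : perm_eq (flatten [seq [:: z; M z] | z <- l]) (l ++ map M l).
  elim: l => //= z l IH; rewrite perm_cons.
  by rewrite perm_sym -cat1s perm_catCA /= perm_cons perm_sym.
have s_uniq : uniq s.
  rewrite (perm_uniq (s_perm o)) cat_uniq orbit_uniq.
  rewrite (map_inj_uniq (can_inj MK)) orbit_uniq andbT /=.
  apply/hasPn => y /mapP[z zo ->]; apply/negP => /oS /andP[_].
  have /andP[zS /eqP <-] := oS z zo.
  by rewrite perfect_color //; case: (c z).
have s_path l x : x \in S -> fpath f x l ->
    path e x (M x :: flatten [seq [:: z; M z] | z <- l]) /\
    last x (M x :: flatten [seq [:: z; M z] | z <- l]) = M (last x l).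
  elim: l x => [|y l IH] x xS /=.
    by case: pM => _ /(_ x xS) /andP[_ ->].
  case/andP=> /eqP yE yl; have yS : y \in S by rewrite -yE fS.
  have [/= pe le] := IH y yS yl; split; last by rewrite -le.
  rewrite pe andbT; case: (pM) => _ /(_ x xS) /andP[MxS ->] /=.
  by rewrite -yE; case: pR => _ /(_ _ MxS) /andP[].
have last_in l x : x \in S -> fpath f x l -> last x l \in S.
  by elim: l x => //= y l IH x xS /andP[/eqP <-]; apply: IH; apply: fS.
exists s; split=> //; first by rewrite -(card_uniqP s_uniq) (eq_card s_all).
have := cycle_orbit finj x0; rewrite /s /o /orbit.
case: (order f x0) (order_gt0 f x0) => // k _; rewrite trajectS /= rcons_path.
case/andP=> pt /eqP ft; have [/= /andP[pe1 pe2] le] := s_path _ _ x0S pt.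
rewrite pe1 rcons_path pe2 /= le -[X in e _ X]ft /f.
have lS := last_in _ _ x0S pt.
by case: pR => _ /(_ (M (last x0 (traject f (f x0) k)))); rewrite perfect_mem // => /(_ lS) /andP[].
Qed.

End Matchings.

(** * Dyck words *)

(* [Node a b] is the Dyck word (a)b. *)
Inductive dyck := Eps | Node of dyck & dyck.

Fixpoint dcat (d e : dyck) :=
  if d is Node a b then Node a (dcat b e) else e.

(* The word B(C): every nonempty Dyck word has this form in a unique way. *)
Definition snode B C := dcat B (Node C Eps).

Fixpoint unsnode (d : dyck) : option (dyck * dyck) :=
  if d is Node a b then
    if unsnode b is Some (B, C) then Some (Node a B, C) else Some (Eps, a)
  else None.

(** Turns (P)Q into P(Q): on rooted plane trees the root moves to its first child. *)
Definition drot d := if d is Node P Q then snode P Q else Eps.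

Definition undrot d := if unsnode d is Some (P, Q) then Node P Q else Eps.

Fixpoint npairs d := if d is Node a b then (npairs a + npairs b).+1 else 0.

Fixpoint flat d : seq bool :=
  if d is Node a b then true :: flat a ++ false :: flat b else [::].

Definition is_nil d := if d is Eps then true else false.

Lemma dcatA : associative dcat.
Proof. by elim=> //= a _ b IH d e; rewrite IH. Qed.

Lemma dcatn0 d : dcat d Eps = d.
Proof. by elim: d => //= a _ b ->. Qed.

Lemma dcat_snode B C D : dcat (snode B C) D = dcat B (Node C D).
Proof. by rewrite /snode -dcatA. Qed.

Lemma unsnodeK B C : unsnode (snode B C) = Some (B, C).
Proof. by rewrite /snode; elim: B => //= a _ b ->. Qed.

Lemma is_nil_snode B C : is_nil (snode B C) = false.
Proof. by case: B. Qed.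

Variant snode_spec : dyck -> Type :=
  | SnodeNil : snode_spec Eps
  | SnodeSnode B C : snode_spec (snode B C).

Lemma snodeP d : snode_spec d.
Proof.
elim: d => [|a _ b]; first by constructor.
by case=> [|B C]; [exact: (SnodeSnode Eps a) | exact: (SnodeSnode (Node a B) C)].
Qed.

Lemma drotK : cancel drot undrot.
Proof. by case=> //= P Q; rewrite /undrot unsnodeK. Qed.

Lemma undrotK : cancel undrot drot.
Proof. by move=> d; case: (snodeP d) => // B C; rewrite /undrot unsnodeK. Qed.

Lemma npairs_cat d e : npairs (dcat d e) = npairs d + npairs e.
Proof. by elim: d => //= a _ b ->; rewrite addSn addnA. Qed.

Lemma npairs_snode B C : npairs (snode B C) = (npairs B + npairs C).+1.
Proof. by rewrite npairs_cat /= addn0 addnS. Qed.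

Lemma npairs_rot d : npairs (drot d) = npairs d.
Proof. by case: d => //= P Q; rewrite npairs_snode. Qed.

Lemma flat_cat d e : flat (dcat d e) = flat d ++ flat e.
Proof. by elim: d => //= a _ b ->; rewrite -catA. Qed.

Lemma flat_snode B C : flat (snode B C) = flat B ++ true :: flat C ++ [:: false].
Proof. by rewrite flat_cat. Qed.

Lemma size_flat d : size (flat d) = (npairs d).*2.
Proof. by elim: d => //= a IHa b IHb; rewrite size_cat /= IHa IHb; lia. Qed.

Lemma count_flat d : count id (flat d) = npairs d.
Proof. by elim: d => //= a IHa b IHb; rewrite count_cat /= IHa IHb; lia. Qed.

(** * Factoring bitstrings through their unmatched bits *)

(* [State Ls W Rs] is the bitstring w_z 0 ... w_1 0 W 1 v_1 ... 1 v_o with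
   [Ls = w_1, ..., w_z] and [Rs = v_1, ..., v_o]: the displayed bits are those
   left unmatched when 1 and 0 are read as parentheses. *)
Inductive state := State of seq dyck & dyck & seq dyck.

Fixpoint lbits Ls : seq bool :=
  if Ls is C :: Ls' then lbits Ls' ++ flat C ++ [:: false] else [::].

Fixpoint rbits Rs : seq bool :=
  if Rs is v :: Rs' then true :: flat v ++ rbits Rs' else [::].

Definition build st :=
  let: State Ls W Rs := st in lbits Ls ++ flat W ++ rbits Rs.

(* While parsing, the words right of the centre are kept in reverse order. *)
Definition parse_step st b :=
  let: State Ls W vs := st in
  if b then State Ls W (Eps :: vs) else
  match vs with
  | [::] => State (W :: Ls) Eps [::]
  | [:: v] => State Ls (snode W v) [::]
  | v :: u :: vs' => State Ls W (snode u v :: vs')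
  end.

Definition parse s :=
  let: State Ls W vs := foldl parse_step (State [::] Eps [::]) s in
  State Ls W (rev vs).

Lemma rbits_cat Rs Rs' : rbits (Rs ++ Rs') = rbits Rs ++ rbits Rs'.
Proof. by elim: Rs => //= v Rs ->; rewrite catA. Qed.

Lemma parseK : cancel parse build.
Proof.
move=> s; rewrite /parse; elim/last_ind: s => //= s b.
rewrite -cats1 foldl_cat /=; case: (foldl _ _ _) => Ls W vs IH.
rewrite -{}IH; case: b => /=.
  by rewrite rev_cons -cats1 rbits_cat /= !catA.
case: vs => [|v [|u vs]] /=; rewrite ?rev_cons -?cats1 ?rbits_cat /= ?flat_snode
  -?catA /= -?catA //=.
Qed.

(** Reading a whole Dyck word keeps the unmatched bits and only extends the rightmost word. *)
Definition parse_app st D :=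
  let: State Ls W vs := st in
  if vs is v :: vs' then State Ls W (dcat v D :: vs') else State Ls (dcat W D) [::].

Lemma foldl_flat D st : foldl parse_step st (flat D) = parse_app st D.
Proof.
elim: D st => [|a IHa b IHb] [Ls W [|v vs]] //=; rewrite ?dcatn0 //;
  by rewrite foldl_cat IHa /= IHb /= /snode -dcatA.
Qed.

Lemma buildK : cancel build parse.
Proof.
case=> Ls W Rs; rewrite /parse /build !foldl_cat.
have -> : foldl parse_step (State [::] Eps [::]) (lbits Ls) = State Ls Eps [::].
  by elim: Ls => //= C Ls IH; rewrite !foldl_cat IH foldl_flat.
rewrite foldl_flat /=.
suff H vs : foldl parse_step (State Ls W vs) (rbits Rs) = State Ls W (catrev Rs vs).
  by rewrite H -/(rev Rs) revK.
by elim: Rs vs => //= v Rs IH vs; rewrite foldl_cat foldl_flat IH.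
Qed.

Definition zeros st := let: State Ls _ _ := st in size Ls.
Definition ones st := let: State _ _ Rs := st in size Rs.
Definition center_nil st := let: State _ W _ := st in is_nil W.

(** Matched bits come in pairs of a 1 and a 0, so the length and the numbers of unmatched bits
    determine the level. *)
Lemma size_count_build st :
  size (build st) + ones st = (count id (build st)).*2 + zeros st.
Proof.
have HL Ls : size (lbits Ls) = (count id (lbits Ls)).*2 + size Ls.
  elim: Ls => //= C Ls IH.
  by rewrite !size_cat !count_cat size_flat count_flat IH /=; lia.
have HR Rs : size (rbits Rs) + size Rs = (count id (rbits Rs)).*2.
  elim: Rs => //= v Rs IH.
  by rewrite !size_cat !count_cat size_flat count_flat /=; lia.
case: st => Ls W Rs /=.
by have := HL Ls; have := HR Rs; rewrite !size_cat !count_cat size_flat count_flat; lia.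
Qed.

Definition flip (s t : seq bool) := exists p b q, s = p ++ b :: q /\ t = p ++ ~~ b :: q.

Lemma flip_sym s t : flip s t -> flip t s.
Proof. by case=> p [b [q [-> ->]]]; exists p, (~~ b), q; rewrite negbK. Qed.

Lemma flip_size s t : flip s t -> size s = size t.
Proof. by case=> p [b [q [-> ->]]]; rewrite !size_cat. Qed.

(** * The two matchings *)

(** A step up the Greene-Kleitman chain: the rightmost unmatched 0, which borders the central word,
    becomes the leftmost unmatched 1. *)
Definition gk_up st := if st is State (C :: Ls) W Rs then State Ls C (W :: Rs) else st.
Definition gk_down st := if st is State Ls W (v :: Rs) then State (W :: Ls) v Rs else st.

Inductive move := Up1 | Down1 | KUp | KDown.

(* [KUp] and [KDown] are used only when the central word is empty; there they
   also flip a single bit, since B0 and 1(drot B) differ in one position. *)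
Definition apply_move mv st :=
  let: State Ls W Rs := st in
  match mv with
  | Up1 =>
      if W is Node E F then State Ls Eps (E :: F :: Rs) else
      if Ls is C :: B :: Ls' then State Ls' (snode B C) Rs else st
  | Down1 =>
      if unsnode W is Some (B, C) then State (C :: B :: Ls) Eps Rs else
      if Rs is C :: B :: Rs' then State Ls (Node C B) Rs' else st
  | KUp => if Ls is B :: Ls' then State Ls' W (drot B :: Rs) else st
  | KDown => if Rs is v :: Rs' then State (undrot v :: Ls) W Rs' else st
  end.

Section Moves.

Variable l : nat.

(* For strings of length 2m+1 this says that the weight is between m+1-l and m+l. *)
Definition valid_zo z o := [&& z <= o + (l.*2).-1, o <= z + (l.*2).-1 & odd (z + o)].
Definition valid st := valid_zo (zeros st) (ones st).

(* The 2l levels are grouped into l pairs of consecutive ones; the top level is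
   in an upper part. *)
Definition low_part z o := odd (z + (l.*2).-1 - o)./2.

(** A chain with [z + o] unmatched bits has [z + o + 1] vertices. If [z + o <= (l.*2).-1], it lies
    within the 2l levels and is paired from its bottom, where [o] is 0. Longer chains are cut off
    and paired along the pairs of levels. *)
Definition gk_dir z o := if z + o <= (l.*2).-1 then ~~ odd o else low_part z o.

(** [Up1] and [Down1] preserve [z + o + (~~ nilW).*2]. If this exceeds 2l, they follow the pairs of
    levels. Otherwise a nonempty central word is split, to the right if [z] is 0 and to the left if
    not. States with empty centre not reached in this way have [z] equal to 1 or 2, or [z] equal to
    0 and [o] to 1; [KUp] and [KDown] pair these. *)
Definition choose_move z o nilW :=
  if (l.*2).+1 <= z + o + (~~ nilW).*2 then
    if low_part z o then Up1 else Down1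
  else if ~~ nilW then if z == 0 then Up1 else Down1
  else match z with
  | 0 => if o == 1 then KDown else Down1
  | 1 => if o == 0 then KUp else KDown
  | 2 => KUp
  | _ => Up1
  end.

Definition gk st := if gk_dir (zeros st) (ones st) then gk_up st else gk_down st.

Definition mate st := apply_move (choose_move (zeros st) (ones st) (center_nil st)) st.

Hypothesis l_gt0 : 0 < l.

Lemma gk_spec st : valid st ->
  [/\ valid (gk st), gk (gk st) = st & flip (build st) (build (gk st))].
Proof.
case: st => Ls W Rs; rewrite /valid /gk /=.
case: ifP => dir.
  case: Ls dir => [|C Ls] /= dir va.
    by move: dir va; rewrite /gk_dir /low_part /valid_zo; case: ifP; lia.
  split.
  - by move: dir va; rewrite /gk_dir /low_part /valid_zo; case: ifP; lia.
  - have -> : gk_dir (size Ls) (size Rs).+1 = false => //.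
    by move: dir va; rewrite /gk_dir /low_part /valid_zo; do 2 case: ifP; lia.
  - exists (lbits Ls ++ flat C), false, (flat W ++ rbits Rs).
    by rewrite -!catA.
case: Rs dir => [|v Rs] /= dir va.
  by move: dir va; rewrite /gk_dir /low_part /valid_zo; case: ifP; lia.
split.
- by move: dir va; rewrite /gk_dir /low_part /valid_zo; case: ifP; lia.
- have -> : gk_dir (size Ls).+1 (size Rs) => //.
  by move: dir va; rewrite /gk_dir /low_part /valid_zo; do 2 case: ifP; lia.
- exists (lbits Ls ++ flat W), true, (flat v ++ rbits Rs).
  by rewrite -!catA.
Qed.

Lemma flip_node Ls E F Rs :
  flip (build (State Ls (Node E F) Rs)) (build (State Ls Eps (E :: F :: Rs))).
Proof.
exists (lbits Ls ++ true :: flat E), false, (flat F ++ rbits Rs).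
by rewrite /= -?catA /= -?catA.
Qed.

Lemma flip_snode Ls B C Rs :
  flip (build (State Ls (snode B C) Rs)) (build (State (C :: B :: Ls) Eps Rs)).
Proof.
exists (lbits Ls ++ flat B), true, (flat C ++ false :: rbits Rs).
by rewrite /= flat_snode -?catA /= -?catA.
Qed.

Lemma flip_rot Ls B Rs :
  flip (build (State (B :: Ls) Eps Rs)) (build (State Ls Eps (drot B :: Rs))).
Proof.
case: B => [|P Q] /=.
  by exists (lbits Ls), false, (rbits Rs); rewrite -?catA.
exists (lbits Ls ++ true :: flat P), false, (flat Q ++ false :: rbits Rs).
by rewrite flat_snode -?catA /= -?catA /= -?catA.
Qed.

Ltac zo := rewrite /valid_zo /choose_move /low_part /=; move=> *;
  repeat match goal with
  | H : context [if ?b then _ else _] |- _ => destruct b eqn:?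
  | |- context [if ?b then _ else _] => destruct b eqn:?
  end; try discriminate; try reflexivity; try lia.

(** This and the next five lemmas show that the partner chooses the inverse move, which makes [mate]
    an involution. *)
Lemma choose_Up1_nil z o : valid_zo z o -> choose_move z o true = Up1 ->
  exists z', [/\ z = z'.+2, valid_zo z' o & choose_move z' o false = Down1].
Proof.
case: z => [|[|[|z]]]; [zo|zo| |].
  by move=> va cm; exists 0; split; move: va cm; zo.
move=> va cm; exists z.+1; split; move: va cm; zo.
Qed.

Lemma choose_Up1_node z o : valid_zo z o -> choose_move z o false = Up1 ->
  valid_zo z o.+2 /\ choose_move z o.+2 true = Down1.
Proof. case: z => [|[|[|z]]] va cm; split; move: va cm; zo. Qed.

Lemma choose_Down1_nil z o : valid_zo z o -> choose_move z o true = Down1 ->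
  exists o', [/\ o = o'.+2, valid_zo z o' & choose_move z o' false = Up1].
Proof.
case: o => [|[|o]]; [case: z => [|[|[|z]]]; zo..|].
case: z => [|[|[|z]]] va cm; exists o; split; move: va cm; zo.
Qed.

Lemma choose_Down1_node z o : valid_zo z o -> choose_move z o false = Down1 ->
  valid_zo z.+2 o /\ choose_move z.+2 o true = Up1.
Proof. case: z => [|[|[|z]]] va cm; split; move: va cm; zo. Qed.

Lemma choose_KUp z o b : valid_zo z o -> choose_move z o b = KUp ->
  b /\ exists z', [/\ z = z'.+1, valid_zo z' o.+1 & choose_move z' o.+1 true = KDown].
Proof.
case: z => [|[|[|z]]] va cm; split; try (by move: va cm; zo).
- by exists 0; split; move: va cm; zo.
- by exists 1; split; move: va cm; zo.
Qed.

Lemma choose_KDown z o b : valid_zo z o -> choose_move z o b = KDown ->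
  b /\ exists o', [/\ o = o'.+1, valid_zo z.+1 o' & choose_move z.+1 o' true = KUp].
Proof.
case: o => [|o]; first by case: z => [|[|[|z]]]; zo.
case: z => [|[|[|z]]] va cm; split; try (by move: va cm; zo);
  by exists o; split; move: va cm; zo.
Qed.

Lemma mate_spec st : valid st ->
  [/\ valid (mate st), mate (mate st) = st & flip (build st) (build (mate st))].
Proof.
case: st => Ls W Rs; rewrite /valid /mate /=.
case cm: choose_move => va /=.
- case: W cm => [|E F] /= cm.
    have [z' [zE va' cm']] := choose_Up1_nil va cm.
    case: Ls zE {va cm} => [|C [|B Ls]] //= [zE]; rewrite -{}zE in va' cm' *.
    rewrite is_nil_snode cm' /=; split=> //.
      by rewrite unsnodeK.
    by apply: flip_sym; apply: flip_snode.
  by have [va' cm'] := choose_Up1_node va cm; rewrite /= cm'; split=> //; apply: flip_node.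
- case: (snodeP W) cm => [|B C] cm /=.
    have [o' [oE va' cm']] := choose_Down1_nil va cm.
    case: Rs oE {va cm} => [|C [|B Rs]] //= [oE]; rewrite -{}oE in va' cm' *.
    by rewrite cm'; split=> //; apply: flip_sym; apply: flip_node.
  rewrite is_nil_snode in cm; have [va' cm'] := choose_Down1_node va cm.
  by rewrite unsnodeK /= cm'; split=> //; apply: flip_snode.
- have [nW [z' [zE va' cm']]] := choose_KUp va cm.
  case: W nW {cm va} => // _.
  case: Ls zE => [|B Ls] //= [zE]; rewrite -{}zE in va' cm' *.
  by rewrite cm' /= drotK; split=> //; apply: flip_rot.
- have [nW [o' [oE va' cm']]] := choose_KDown va cm.
  case: W nW {cm va} => // _.
  case: Rs oE => [|v Rs] //= [oE]; rewrite -{}oE in va' cm' *.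
  rewrite cm' /= undrotK; split=> //; apply: flip_sym.
  by rewrite -{2}[v]undrotK; apply: flip_rot.
Qed.

End Moves.

(** * Relations on Dyck words whose classes are the words of equal length *)

Section Equivalences.

Variable E : dyck -> dyck -> Prop.
Hypothesis E_sym : forall w w', E w w' -> E w' w.
Hypothesis E_trans : forall w1 w2 w3, E w1 w2 -> E w2 w3 -> E w1 w3.

(** (P1)P2X rotates to P1(P2X); by induction P1 moves to the end, giving (P2X)P1; this rotates to
    P2X(P1), and by induction P2 moves to the end. *)
Lemma rot_dcatC : (forall P Q, E (Node P Q) (snode P Q)) -> E Eps Eps ->
  forall P X, E (dcat P X) (dcat X P).
Proof.
move=> Erot E0; have refl w : E w w.
  by case: w => // P Q; apply: E_trans (Erot P Q) _; apply: E_sym.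
elim=> [X|P1 IH1 P2 IH2 X] /=; first by rewrite dcatn0.
apply: E_trans (Erot _ _) _; apply: E_trans (IH1 _) _.
apply: E_trans (Erot _ _) _; rewrite /snode -dcatA.
by apply: E_trans (IH2 _) _; rewrite -dcatA.
Qed.

End Equivalences.

(* Under either pair of rules every nonempty word is equivalent to some ()w, and
   the relation w ~ w' iff ()w ~ ()w' inherits the rules. *)
Lemma wrap_rule_total (E : dyck -> dyck -> Prop) :
  (forall w, E w w) -> (forall w w', E w w' -> E w' w) ->
  (forall w1 w2 w3, E w1 w2 -> E w2 w3 -> E w1 w3) ->
  (forall C B D, E (dcat C (Node B D)) (Node C (dcat (drot B) D))) ->
  forall w w', npairs w = npairs w' -> E w w'.
Proof.
move=> + + + + w w' eq_n; move En: (npairs w) eq_n => n /esym.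
elim: n w w' En E => [|n IH] w w' En E En' Er Es Et Eg.
  by case: w w' En En' => [|? ?] [|? ?].
case: w w' En En' => [|B D] // [|B' D'] //= [En] [En'].
apply: (Et _ _ _ (Eg Eps B D)); apply: (Es _ _); apply: (Et _ _ _ (Eg Eps B' D')); apply: (Es _ _) => /=.
apply: (IH _ _ _ (fun w w' => E (Node Eps w) (Node Eps w'))) => //.
- by rewrite npairs_cat npairs_rot.
- by rewrite npairs_cat npairs_rot.
- by move=> w1 w2; apply: (Es _ _).
- by move=> w1 w2 w3; apply: (Et _ _ _).
(* The first use has [Node Eps C0] as left factor and wraps the leading () as well; the second
   brings it back to the front, as [drot (Node Eps C0)] is [Node C0 Eps]. *)
- move=> C0 B0 D0; apply: (Et _ _ _ (Eg (Node Eps C0) B0 D0)).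
  exact: (Eg Eps (Node Eps C0)).
Qed.

Lemma pull_rule_total (E : dyck -> dyck -> Prop) :
  (forall w, E w w) -> (forall w w', E w w' -> E w' w) ->
  (forall w1 w2 w3, E w1 w2 -> E w2 w3 -> E w1 w3) ->
  (forall P Q, E (Node P Q) (snode P Q)) ->
  (forall u v, E (Node (Node Eps u) v) (Node Eps (Node u v))) ->
  forall w w', npairs w = npairs w' -> E w w'.
Proof.
move=> + + + + + w w' eq_n; move En: (npairs w) eq_n => n /esym.
elim: n w w' En E => [|n IH] w w' En E En' Er Es Et Erot Epull.
  by case: w w' En En' => [|? ?] [|? ?].
(* Rotating ((P1)P2)Q to (P1)P2(Q) shrinks the first factor until it is (). *)
have leaf_first k P Q : npairs P < k ->
    exists2 w1, E (Node P Q) (Node Eps w1) & npairs w1 = npairs P + npairs Q.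
  elim: k P Q => // k IHk [|P1 P2] Q /= lek; first by exists Q.
  have [|w1 Hw sw] := IHk P1 (snode P2 Q); first by lia.
  exists w1; first exact: (Et _ _ _ (Erot (Node P1 P2) Q) Hw).
  by rewrite sw npairs_snode; lia.
have to_leaf x : npairs x = n.+1 -> exists2 w1, E x (Node Eps w1) & npairs w1 = n.
  case: x => // P Q [<-]; have [w1 ? ?] := leaf_first _ P Q (ltnSn _).
  by exists w1.
have [w1 Ew1 sw1] := to_leaf w En; have [w2 Ew2 sw2] := to_leaf w' En'.
apply: (Et _ _ _ Ew1); apply: (Es _ _); apply: (Et _ _ _ Ew2); apply: (Es _ _).
(* The pull rule, read backwards, absorbs the leading () into the next factor, so that the whole
   word can be rotated. *)
have Erot' P Q : E (Node Eps (Node P Q)) (Node Eps (snode P Q)).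
  apply: (Et _ _ _ (Es _ _ (Epull P Q))).
  exact: Erot (Node Eps P) Q.
apply: (IH _ _ _ (fun w w' => E (Node Eps w) (Node Eps w'))) => //.
- by move=> x y; apply: (Es _ _).
- by move=> x y z; apply: (Et _ _ _).
(* The leading () is moved to the end, the pull rule is applied at the front, and commutation behind
   the new leading () brings the moved pair back. *)
move=> u v; have comm := rot_dcatC Es Et Erot (Er _).
have comm' := @rot_dcatC (fun w w' => E (Node Eps w) (Node Eps w'))
  (fun _ _ => @Es _ _) (fun _ _ _ => @Et _ _ _) Erot' (Er _).
apply: (Et _ _ _ (comm (Node Eps Eps) _)) => /=; apply: (Et _ _ _ (Epull _ _)).
exact: comm' (Node u v) (Node Eps Eps).
Qed.

(** * Connectivity of the union of the two matchings *)

(** For [s < l], [State (C :: Ls) W Rs] is then the lower end of an edge of the chain matching, on a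
    chain with 2s + 2 vertices, and represents this edge. *)
Definition node_size s (Ls Rs : seq dyck) :=
  [&& ~~ odd (size Ls), ~~ odd (size Rs) & size Ls + size Rs == s.*2].

Lemma node_size2 s A B Ls Rs : node_size s.+1 (A :: B :: Ls) Rs = node_size s Ls Rs.
Proof. by rewrite /node_size /=; lia. Qed.

Lemma node_size2r s A B Ls Rs : node_size s.+1 Ls (A :: B :: Rs) = node_size s Ls Rs.
Proof. by rewrite /node_size /=; lia. Qed.

Lemma gk_node l s C Ls W Rs : node_size s Ls Rs -> s < l ->
  gk l (State (C :: Ls) W Rs) = State Ls C (W :: Rs).
Proof.
move=> ns ltsl; rewrite /gk /=; have -> // : gk_dir l (size Ls).+1 (size Rs).
by move: ns; rewrite /node_size /gk_dir; case: ifP; lia.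
Qed.

Lemma node_valid l s C Ls W Rs : node_size s Ls Rs -> s < l ->
  valid l (State (C :: Ls) W Rs).
Proof. by rewrite /node_size /valid /valid_zo /=; lia. Qed.

Section Connectivity.

(** [E] stands for lying on one cycle after all exchanges; what these achieve enters as [E_pull] or
    [E_split]. *)
Variables (l : nat) (E : state -> state -> Prop).
Hypothesis l_gt0 : 0 < l.
Hypothesis E_refl : forall st, E st st.
Hypothesis E_sym : forall st st', E st st' -> E st' st.
Hypothesis E_trans : forall st1 st2 st3, E st1 st2 -> E st2 st3 -> E st1 st3.
Hypothesis E_size : forall st st', E st st' -> size (build st) = size (build st').
Hypothesis E_gk : forall st, valid l st -> E st (gk l st).
Hypothesis E_mate : forall st, valid l st -> E st (mate l st).

(** The state is at the upper level of a pair, on a chain that meets all 2l levels; the chain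
    matching leads down from it. *)
Definition upper z o := [&& valid_zo l z o, ~~ low_part l z o & (l.*2).-1 <= z + o].

Lemma upper_pair z o : upper z o -> upper z.+1 o.+1.
Proof. by rewrite /upper /valid_zo /low_part; lia. Qed.

Lemma upper_unpair z o : l.*2 < z + o -> upper z o ->
  exists z' o', [/\ z = z'.+1, o = o'.+2 & upper z' o'.+1].
Proof.
by case: z o => [|z] [|[|o]]; rewrite /upper /valid_zo /low_part => ? ?;
  [exfalso; lia..|exists z, o; split; lia].
Qed.

Lemma E_gk_down Ls W v Rs : upper (size Ls) (size Rs).+1 ->
  E (State Ls W (v :: Rs)) (State (W :: Ls) v Rs).
Proof.
move=> up; have := @E_gk (State Ls W (v :: Rs)); rewrite /valid /gk /=.
have -> : gk_dir l (size Ls) (size Rs).+1 = false.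
  by move: up; rewrite /upper /valid_zo /gk_dir /low_part; case: ifP; lia.
by case/and3P: up => va _ _; apply.
Qed.

Lemma E_snode Ls B C Rs : upper (size Ls) (size Rs) ->
  E (State Ls (snode B C) Rs) (State (B :: Ls) C (Eps :: Rs)).
Proof.
move=> up; have := @E_mate (State Ls (snode B C) Rs).
rewrite /valid /mate /= is_nil_snode.
have -> : choose_move l (size Ls) (size Rs) false = Down1.
  rewrite /choose_move (_ : l.*2 < _); last by move: up; rewrite /upper; lia.
  by case/and3P: up => _ /negbTE-> _.
case/and3P: (up) => va _ _ /(_ va) /=; rewrite unsnodeK => H; apply: E_trans H _.
by apply: E_sym; apply: E_gk_down; apply: upper_pair.
Qed.

Lemma E_nil Ls C F G Rs : upper (size Ls) (size Rs).+1 ->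
  E (State (C :: Ls) Eps (F :: G :: Rs)) (State Ls C (Node F G :: Rs)).
Proof.
move=> up; have := @E_mate (State (C :: Ls) Eps (F :: G :: Rs)).
have up2 := upper_pair up.
rewrite /valid /mate /=.
have -> : choose_move l (size Ls).+1 (size Rs).+2 true = Down1.
  rewrite /choose_move (_ : l.*2 < _); last by move: up; rewrite /upper; lia.
  by case/and3P: up2 => _ /negbTE-> _.
case/and3P: (up2) => va _ _ /(_ va) /= H; apply: E_trans H _.
by apply: E_sym; apply: E_gk_down.
Qed.

(** For W = B(C), [E_snode] moves B to the left, C is absorbed by induction, [E_nil] returns B to
    the centre and joins (C) to the right word, and B is absorbed by induction. *)
Lemma E_center Ls W v Rs : upper (size Ls) (size Rs).+1 ->
  E (State Ls W (v :: Rs)) (State Ls Eps (dcat W v :: Rs)).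
Proof.
have [n] := ubnP (npairs W).
elim: n Ls W v Rs => // n IH Ls W v Rs; case: (snodeP W) => [|B C] //= lt_n up.
rewrite npairs_snode in lt_n; rewrite dcat_snode.
have upp := upper_pair up.
apply: E_trans (E_snode _ _ _) _ => //=.
apply: E_trans (IH _ _ _ _ _ _) _ => //=; first by lia.
rewrite dcatn0; apply: E_trans (E_nil _ _ _ _) _ => //.
by apply: IH => //; lia.
Qed.

Lemma node_upper Ls Rs : node_size l.-1 Ls Rs -> upper (size Ls) (size Rs).+1.
Proof. by rewrite /node_size /upper /valid_zo /low_part; lia. Qed.

(** On long chains [E_center] and [E_nil] remove one unmatched 0 and one unmatched 1 at a time,
    until the chain has 2l vertices and its edge is a node with s = l - 1. On shorter chains the
    state or its chain partner is a node. *)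
Lemma valid_node st : valid l st ->
  exists C Ls W Rs s, [/\ E st (State (C :: Ls) W Rs), node_size s Ls Rs & s < l].
Proof.
have HU n Ls W Rs : size Ls + size Rs <= n -> upper (size Ls) (size Rs) ->
  exists C Ls' W' Rs' s,
    [/\ E (State Ls W Rs) (State (C :: Ls') W' Rs'), node_size s Ls' Rs' & s < l].
  elim: n Ls W Rs => [|n IH] Ls W Rs; first by rewrite /upper; lia.
  move=> le_n up; have [big|small] := ltnP l.*2 (size Ls + size Rs).
    have [z' [o' [zE oE up']]] := upper_unpair big up.
    case: Ls Rs zE oE le_n {big} up => [|C Ls] //= [|F [|G Rs]] //= [zE] [oE] le_n up.
    rewrite -zE -oE in up'.
    have [||A [Ls1 [W1 [Rs1 [s [H ? ?]]]]]] := IH Ls C (Node (dcat W F) G :: Rs) => //=.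
      by lia.
    exists A, Ls1, W1, Rs1, s; split=> //; apply: E_trans H.
    apply: E_trans (E_center _ _ _) _ => //.
    exact: E_nil.
  case: Rs le_n small up => [|v Rs] /= le_n small up.
    by move: up; rewrite /upper /valid_zo /low_part; lia.
  exists W, Ls, v, Rs, l.-1; split; [exact: E_gk_down| |by lia].
  by move: up small; rewrite /upper /node_size /valid_zo /low_part; lia.
case: st => Ls W Rs; rewrite {1}/valid /= => va.
have [big|small] := leqP (l.*2).-1 (size Ls + size Rs).
  have [low|high] := boolP (low_part l (size Ls) (size Rs)); last first.
    by apply: (HU _ _ _ _ (leqnn _)); rewrite /upper va high.
  case: Ls va low big => [|C Ls] /= va low big.
    by move: va low big; rewrite /valid_zo /low_part; lia.
  have up : upper (size Ls) (size Rs).+1.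
    by move: va low big; rewrite /upper /valid_zo /low_part; lia.
  have [A [Ls1 [W1 [Rs1 [s [H ? ?]]]]]] := HU _ Ls C (W :: Rs) (leqnn _) up.
  exists A, Ls1, W1, Rs1, s; split=> //; apply: E_trans H.
  by apply: E_sym; apply: E_gk_down.
have := @E_gk (State Ls W Rs) va; rewrite /gk /= /gk_dir ltnW //.
have [oo|eo] := boolP (odd (size Rs)) => /= H.
  case: Rs oo H va small => [|v Rs] //= oo H va small.
  exists W, Ls, v, Rs, (size Ls + size Rs)./2; split=> //.
    by move: va oo; rewrite /node_size /valid_zo; lia.
  by lia.
case: Ls va small {H} => [|C Ls] /= va small.
  by move: va eo; rewrite /valid_zo; lia.
exists C, Ls, W, Rs, (size Ls + size Rs)./2; split=> //.
  by move: va eo; rewrite /node_size /valid_zo; lia.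
by lia.
Qed.

Lemma E_top_center C Ls W Rs : node_size l.-1 Ls Rs ->
  E (State (C :: Ls) W Rs) (State (Eps :: Ls) (dcat C W) Rs).
Proof.
move=> /node_upper up; apply: E_trans (E_sym (E_gk_down _ _ _)) _ => //.
by apply: E_trans (E_center _ _ _) _ => //; apply: E_gk_down.
Qed.

Lemma size_node1 C W Rs : size (build (State [:: C] W Rs)) =
  (npairs C + npairs W).*2.+1 + size (rbits Rs).
Proof. by rewrite /= !size_cat /= !size_flat; lia. Qed.

(** Every class contains a string 0W. Following both matchings rotates W, and [E_pull] supplies the
    other rule of [pull_rule_total]. *)
Lemma connected1 : l = 1 ->
  (forall u v, E (State [:: Node (Node Eps u) v] Eps [::])
                 (State [:: Node Eps (Node u v)] Eps [::])) ->
  forall st st', valid l st -> valid l st' -> size (build st) = size (build st') ->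
  E st st'.
Proof.
move=> l1 E_pull.
have E_top C W : E (State [:: C] W [::]) (State [:: Eps] (dcat C W) [::]).
  by apply: E_top_center; rewrite l1.
have reduce st : valid l st -> exists W, E st (State [:: Eps] W [::]).
  case/valid_node => C [[|? ?] [W [[|? ?] [s [Est]]]]]; rewrite l1 /node_size /=;
    try lia.
  by exists (dcat C W); apply: E_trans Est (E_top _ _).
have E_drot B : E (State [:: Eps] B [::]) (State [:: Eps] (drot B) [::]).
  have := E_top B Eps; rewrite dcatn0 => /E_sym H; apply: E_trans H _.
  have := @E_mate (State [:: B] Eps [::]); rewrite /mate l1 /= => H.
  apply: E_trans (H isT) _; apply: E_gk_down.
  by rewrite /upper l1.
pose Ec V V' := E (State [:: Eps] V [::]) (State [:: Eps] V' [::]).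
have Ec_total : forall V V', npairs V = npairs V' -> Ec V V'.
  apply: pull_rule_total.
  - by move=> w; apply: E_refl.
  - by move=> w w'; apply: E_sym.
  - by move=> w1 w2 w3; apply: E_trans.
  - by move=> P Q; apply: E_drot.
  - move=> u v; have := E_pull u v => /E_trans/(_ (E_top _ _)).
    rewrite dcatn0 => /(E_trans (E_sym (E_top _ _))).
    by rewrite dcatn0.
move=> st st' /reduce[V EV] /reduce[V' EV'] szE.
apply: (E_trans EV (E_trans _ (E_sym EV'))); apply: Ec_total.
by move: szE; rewrite (E_size EV) (E_size EV') !size_node1 /=; lia.
Qed.

(** * Linking chains of different lengths, for l > 1 *)

Section Nodes.

Hypothesis l_gt1 : 1 < l.
Hypothesis E_split : forall s A B Ls W Rs, node_size s Ls Rs -> s.+1 < l ->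
  E (State (snode A B :: Ls) W Rs) (State (Eps :: B :: A :: Ls) W Rs).

Lemma E_node_gk s C Ls W Rs : node_size s Ls Rs -> s < l ->
  E (State (C :: Ls) W Rs) (State Ls C (W :: Rs)).
Proof.
move=> ns ltsl; rewrite -(gk_node C W ns ltsl); apply: E_gk.
exact: node_valid ns ltsl.
Qed.

Lemma E_node_down s C Ls B F Rs : node_size s Ls Rs -> s.+1 < l ->
  E (State (C :: Ls) (snode B F) Rs) (State (F :: B :: C :: Ls) Eps Rs).
Proof.
move=> ns ltsl; have := @E_mate (State (C :: Ls) (snode B F) Rs).
rewrite /valid /mate /= is_nil_snode.
have -> : choose_move l (size Ls).+1 (size Rs) false = Down1.
  rewrite /choose_move (_ : l.*2 < _ = false) //=.
  by move: ns; rewrite /node_size; lia.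
rewrite /= unsnodeK; apply.
by move: ns; rewrite /node_size /valid_zo; lia.
Qed.

Lemma E_node_up s F G W Rs : node_size s [::] Rs -> s.+1 < l ->
  E (State [:: Node F G] W Rs) (State [:: Eps] F (G :: W :: Rs)).
Proof.
move=> ns ltsl; apply: E_trans (E_node_gk _ _ ns (ltnW ltsl)) _.
have := @E_mate (State [::] (Node F G) (W :: Rs)); rewrite /valid /mate /=.
have -> : choose_move l 0 (size Rs).+1 false = Up1.
  rewrite /choose_move (_ : l.*2 < _ = false) //=.
  by move: ns; rewrite /node_size /=; lia.
move=> H; apply: E_trans (H _) _.
  by move: ns; rewrite /node_size /valid_zo /=; lia.
apply: E_sym; apply: (@E_node_gk s.+1) => //.
by move: ns; rewrite /node_size /=; lia.
Qed.

Lemma E_node_rot s B X W Rs : node_size s [::] Rs -> s.+1 < l ->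
  E (State [:: Eps; B; X] W Rs) (State [:: X] Eps (drot B :: W :: Rs)).
Proof.
move=> ns ltsl; apply: (E_trans (@E_node_gk s.+1 _ _ _ _ _ _)) => //.
have := @E_mate (State [:: B; X] Eps (W :: Rs)); rewrite /valid /mate /=.
have -> : choose_move l 2 (size Rs).+1 true = KUp.
  rewrite /choose_move (_ : l.*2 < _ = false) //=.
  by move: ns; rewrite /node_size /=; lia.
by apply; move: ns; rewrite /node_size /valid_zo /=; lia.
Qed.

(* Transfers between the two central words; the new words depend neither on
   the outer words nor on the part [C] that stays in place. *)
Lemma transfer s : s < l ->
  (forall W, exists2 V, npairs V = npairs W & forall C Ls Rs, node_size s Ls Rs ->
     E (State (C :: Ls) W Rs) (State (dcat C V :: Ls) Eps Rs)) /\
  (forall V W, exists2 W', npairs W' = npairs V + npairs W &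
     forall C Ls Rs, node_size s Ls Rs ->
     E (State (dcat C V :: Ls) W Rs) (State (C :: Ls) W' Rs)).
Proof.
(* The induction starts at s = l - 1, where [E_top_center] applies, and goes down. *)
move: {2}(l - s.+1) (erefl (l - s.+1)) => k; elim: k s => [|k IH] s ks ltsl.
  have -> : s = l.-1 by lia.
  split=> [W | V W].
    exists W => // C Ls Rs ns; apply: E_trans (E_top_center _ _ ns) _.
    by have := E_top_center (dcat C W) Eps ns; rewrite dcatn0 => /E_sym.
  exists (dcat V W); first by rewrite npairs_cat.
  move=> C Ls Rs ns; apply: E_trans (E_top_center _ _ ns) _.
  by rewrite -dcatA; apply: E_sym; apply: E_top_center.
have lt1 : s.+1 < l by lia.
have [IHA IHB] := IH s.+1 ltac:(lia) lt1.
split=> [W | V W].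
  have [n] := ubnP (npairs W); elim: n W => // n IHn W.
  case: (snodeP W) => [_|B F].
    by exists Eps => // C Ls Rs ns; rewrite dcatn0.
  rewrite npairs_snode => lt_n; have [W' nW' HW'] := IHB F Eps.
  rewrite addn0 in nW'; have [|V nV HV] := IHn W'; first by lia.
  (* For W = B(F), [mate] makes B and F outer words, F becomes the centre [W'] by the case s + 1,
     and undoing a split turns C into C(B). The word [W'] is shorter than W, so induction moves
     it. *)
  exists (Node B V); first by rewrite /= nV; lia.
  move=> C Ls Rs ns; apply: E_trans (E_node_down _ _ _ ns lt1) _.
  apply: E_trans (HW' Eps _ _ _) _; first by rewrite node_size2.
  apply: E_trans (E_sym (E_split _ _ _ ns lt1)) _.
  by rewrite -dcat_snode; apply: HV.
have [n] := ubnP (npairs V); elim: n V W => // n IHn V W.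
case: (snodeP V) => [_|B F].
  by exists W => // C Ls Rs ns; rewrite dcatn0.
(* A split frees F, which returns to the centre followed by ([V1]), where [V1] comes from W; B is
   then moved by induction. *)
rewrite npairs_snode => lt_n; have [V1 nV1 HV1] := IHA W.
have [|W' nW' HW'] := IHn B (snode F V1); first by lia.
exists W'; first by rewrite nW' npairs_snode; lia.
move=> C Ls Rs ns; rewrite /snode dcatA.
apply: E_trans (E_split _ _ _ ns lt1) _.
apply: E_trans (HV1 _ _ _ _) _; first by rewrite node_size2.
by apply: E_trans (E_sym (E_node_down _ _ _ ns lt1)) _; apply: HW'.
Qed.

Lemma E_node1_step s Rs W C C' : node_size s [::] Rs -> s.+1 < l ->
  (forall X Rs', node_size s.+1 [::] Rs' ->
     E (State [:: X] Eps Rs') (State [:: Eps] X Rs')) ->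
  npairs C = npairs C' -> E (State [:: C] W Rs) (State [:: C'] W Rs).
Proof.
move=> ns ltsl move_in.
suff H w w' : npairs w = npairs w' ->
    forall V, E (State [:: w] V Rs) (State [:: w'] V Rs) by move/H.
move: w w'; apply: wrap_rule_total.
- by move=> w V; apply: E_refl.
- by move=> w w' H V; apply: E_sym.
- by move=> w1 w2 w3 H1 H2 V; apply: E_trans (H1 V) (H2 V).
(* D is parked in the centre as [V'], the same word on both sides. After X(B) is split, [E_node_rot]
   rotates B, [move_in] puts X in the centre, and [E_node_up] read backwards wraps it, giving (X)
   followed by [drot B]. *)
move=> X B D V; have [_ HB] := transfer (ltnW ltsl); have [V' _ HV'] := HB D V.
have := HV' (snode X B) _ _ ns; rewrite dcat_snode => H; apply: E_trans H _.
have := HV' (Node X (drot B)) _ _ ns => /= /E_sym; apply: E_trans.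
apply: E_trans (E_split _ _ _ ns ltsl) _.
apply: E_trans (E_node_rot _ _ _ ns ltsl) _.
apply: E_trans (move_in _ _ _) _; first by rewrite node_size2r.
by apply: E_sym; apply: E_node_up ns ltsl.
Qed.

(** The premise [move_in] follows from the case s + 1: the central word is transferred to the left,
    where any word of the same length may replace it. *)
Lemma E_node1 s Rs W C C' : node_size s [::] Rs -> s.+1 < l -> npairs C = npairs C' ->
  E (State [:: C] W Rs) (State [:: C'] W Rs).
Proof.
move: {2}(l - s.+2) (erefl (l - s.+2)) => k.
elim: k s Rs W C C' => [|k IH] s Rs W C C' ks ns ltsl;
  apply: (E_node1_step _ ns ltsl) => X R'.
  have -> : s.+1 = l.-1 by lia.
  by move=> ns'; have := E_top_center X Eps ns'; rewrite dcatn0.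
move=> ns'; have [HA _] := transfer ltsl; have [V nV HV] := HA X.
apply: E_sym; apply: E_trans (HV _ _ _ ns') _ => /=.
by apply: (IH s.+1) => //; lia.
Qed.

Lemma connected st st' : valid l st -> valid l st' ->
  size (build st) = size (build st') -> E st st'.
Proof.
(* Outer words are absorbed two at a time, by [E_node_up] on the right and [E_node_down] on the
   left, both read backwards. *)
have reduce s C Ls W Rs : node_size s Ls Rs -> s < l ->
    exists C', E (State (C :: Ls) W Rs) (State [:: C'] Eps [::]).
  elim: s C Ls W Rs => [|s IH] C Ls W Rs.
    case: Ls => [|? ?]; case: Rs => [|? ?]; rewrite /node_size /=; try lia.
    move=> _ l0; have [HA _] := transfer l0; have [V _ HV] := HA W.
    by exists (dcat C V); apply: HV.
  move=> ns ltsl; have [HA HB] := transfer ltsl.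
  case: Ls ns => [|A [|B Ls]] ns.
  - case: Rs ns => [|F [|G Rs]] ns; try by move: ns; rewrite /node_size /=; lia.
    have [W' _ HW'] := HB C W.
    have ns' : node_size s [::] Rs by rewrite node_size2r in ns.
    have [C' HC'] := IH (Node W' F) [::] G Rs ns' (ltnW ltsl).
    exists C'; apply: E_trans (HW' Eps _ _ ns) _; apply: E_trans HC'.
    by apply: E_sym; apply: E_node_up ns' ltsl.
  - by move: ns; rewrite /node_size /=; lia.
  have [V _ HV] := HA W; have ns' : node_size s Ls Rs by rewrite node_size2 in ns.
  have [C' HC'] := IH B Ls (snode A (dcat C V)) Rs ns' (ltnW ltsl).
  exists C'; apply: E_trans (HV _ _ _ ns) _; apply: E_trans HC'.
  by apply: E_sym; apply: E_node_down ns' ltsl.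
move=> /valid_node[C [Ls [W [Rs [s [H ns ls]]]]]] /valid_node[C' [Ls' [W' [Rs' [s' [H' ns' ls']]]]]].
have [D HD] := reduce _ C _ W _ ns ls; have [D' HD'] := reduce _ C' _ W' _ ns' ls'.
move=> szE; have EV := E_trans H HD; have EV' := E_trans H' HD'.
apply: (E_trans EV (E_trans _ (E_sym EV'))).
apply: (@E_node1 0) => //.
by move: szE; rewrite (E_size EV) (E_size EV') !size_node1 /=; lia.
Qed.

End Nodes.
End Connectivity.

(** * Transfer to the hypercube *)

Section Hypercube.

Variable n : nat.
Implicit Types x y : bitstring n.

Lemma qadj_sym : symmetric (@qadj n).
Proof. by move=> x y; rewrite /qadj; under eq_finset => i do rewrite eq_sym. Qed.

Lemma qadj_odd_weight x y : qadj x y -> odd (weight y) = ~~ odd (weight x).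
Proof.
case/cards1P=> i0 /setP d; rewrite /weight.
rewrite (cardsD1 i0 [set i | x i]) (cardsD1 i0 [set i | y i]) !inE.
have -> : [set i | y i] :\ i0 = [set i | x i] :\ i0.
  apply/setP => i; rewrite !inE; case: eqVneq => //= ne.
  by move: (d i); rewrite !inE (negbTE ne) => /negbFE/eqP.
by move: (d i0); rewrite !inE eqxx !oddD; case: (x i0); case: (y i0); rewrite ?negbK.
Qed.

Definition bits x : seq bool := [seq x i | i <- enum 'I_n].
Definition of_bits (s : seq bool) : bitstring n := [ffun i : 'I_n => nth false s i].

Lemma size_bits x : size (bits x) = n.
Proof. by rewrite size_map size_enum_ord. Qed.

Lemma bitsK : cancel bits of_bits.
Proof.
move=> x; apply/ffunP => i; rewrite ffunE.
by rewrite (nth_map i) ?size_enum_ord ?ltn_ord // nth_ord_enum.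
Qed.

Lemma of_bitsK s : size s = n -> bits (of_bits s) = s.
Proof.
move=> sz; apply: (@eq_from_nth _ false); rewrite size_bits // => i lt_i.
rewrite (nth_map (Ordinal lt_i)) ?size_enum_ord // ffunE.
by rewrite nth_enum_ord.
Qed.

Lemma count_bits x : count id (bits x) = weight x.
Proof.
rewrite count_map enumT /weight cardsE cardE /enum_mem size_filter.
exact: eq_count.
Qed.

Lemma flip_qadj s t : size s = n -> flip s t -> qadj (of_bits s) (of_bits t).
Proof.
move=> sz [p [b [q [sE tE]]]].
have lt_p : size p < n by rewrite -sz sE size_cat /= addnS ltnS leq_addr.
apply/cards1P; exists (Ordinal lt_p); apply/setP => i.
rewrite !inE !ffunE sE tE !nth_cat -val_eqE /=.
case: ltngtP => [| |->]; rewrite ?eqxx //; last by rewrite subnn; case: b {sE tE}.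
by case E: (i - size p) => [|k] /= lt; rewrite ?eqxx //; lia.
Qed.

Definition enc st := of_bits (build st).
Definition dec x := parse (bits x).

Lemma decK : cancel dec enc.
Proof. by move=> x; rewrite /enc parseK bitsK. Qed.

Lemma encK st : size (build st) = n -> dec (enc st) = st.
Proof. by move=> sz; rewrite /dec of_bitsK // buildK. Qed.

Lemma size_dec x : size (build (dec x)) = n.
Proof. by rewrite parseK size_bits. Qed.

End Hypercube.

(** * The matchings on the middle 2l levels *)

Section MiddleLevels.

Variables m l : nat.
Hypothesis m_gt0 : 0 < m.
Hypothesis l_bounds : 0 < l <= m.+1.

Let n := 2 * m + 1.
Let S : {set bitstring n} := levels n (m.+1 - l) (m + l).
Let e := @qadj n.

Lemma mem_levels x : (x \in S) = valid l (dec x).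
Proof.
rewrite inE -count_bits -[bits x]parseK -/(dec x) /valid /valid_zo.
have := size_count_build (dec x); rewrite size_dec.
by move: l_bounds; rewrite /n; lia.
Qed.

Lemma enc_levels st : size (build st) = n -> (enc n st \in S) = valid l st.
Proof. by move=> sz; rewrite mem_levels encK. Qed.

(** Fixing all vertices outside [S] gives an involution of the whole cube, as [perfect] demands. *)
Definition lift_map (f : state -> state) (x : bitstring n) :=
  if x \in S then enc n (f (dec x)) else x.

Lemma perfect_lift_map f : (forall st, valid l st ->
    [/\ valid l (f st), f (f st) = st & flip (build st) (build (f st))]) ->
  perfect e S (lift_map f).
Proof.
move=> Hf; have sz (x : bitstring n) : valid l (dec x) -> size (build (f (dec x))) = n.
  by case/Hf => _ _ /flip_size <-; apply: size_dec.
split=> [x|x xS]; rewrite /lift_map.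
  have [xS|/negbTE xS] := boolP (x \in S); last by rewrite !xS.
  rewrite mem_levels in xS; have [v fK _] := Hf _ xS.
  by rewrite enc_levels ?sz // v encK ?sz // fK decK.
rewrite xS; rewrite mem_levels in xS; have [v fK fl] := Hf _ xS.
rewrite enc_levels ?sz // v /=; rewrite -{1}[x]decK; apply: flip_qadj fl.
exact: size_dec.
Qed.

Lemma lift_map_enc f st : size (build st) = n -> valid l st ->
  lift_map f (enc n st) = enc n (f st).
Proof. by move=> sz v; rewrite /lift_map enc_levels // v encK. Qed.

Let M0 := lift_map (mate l).
Let R0 := lift_map (gk l).

Let l_gt0 : 0 < l. Proof. by case/andP: l_bounds. Qed.

Lemma perfect_mate : perfect e S M0.
Proof. by apply: perfect_lift_map => st; apply: mate_spec. Qed.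

Lemma perfect_gk : perfect e S R0.
Proof. by apply: perfect_lift_map => st; apply: gk_spec. Qed.

(** The guard on the length makes this an equivalence on all states, including those of strings of
    other lengths. *)
Definition same_cycle (M R : bitstring n -> bitstring n) st st' :=
  size (build st) = size (build st') /\
  (size (build st) = n -> linked M R (enc n st) (enc n st')).

Lemma card_levels : 2 < #|S|.
Proof.
pose ss := [:: nseq m true ++ nseq m.+1 false; nseq m.+1 true ++ nseq m false;
  nseq m.+1 false ++ nseq m true].
have sz s : s \in ss -> size s = n.
  by rewrite !inE; repeat (case/orP); move/eqP => ->; rewrite size_cat !size_nseq /n; lia.
have u : uniq [seq of_bits n s | s <- ss].
  rewrite map_inj_in_uniq; last first.
    by move=> s t ss1 st1 /(congr1 (@bits n)); rewrite !of_bitsK ?sz.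
  rewrite /= !inE negb_or andbT; apply/andP; split.
  - by apply/eqP => /(congr1 (count id)); rewrite /= !count_cat /= !count_nseq /=; lia.
  - by case: m m_gt0.
rewrite -[3](size_map (of_bits n) ss); apply: leq_trans (_ : #|[seq of_bits n s | s <- ss]| <= _).
  by rewrite (card_uniqP u).
apply/subset_leq_card/subsetP => _ /mapP[s sss ->].
rewrite inE -count_bits of_bitsK ?sz //.
move: sss; rewrite !inE; repeat (case/orP); move/eqP => ->;
  by rewrite count_cat !count_nseq /=; move: l_bounds; lia.
Qed.

Lemma hamilton_of_connected M R :
  perfect e S M -> perfect e S R -> subrel (linked M0 R0) (linked M R) ->
  ((forall st, same_cycle M R st st) ->
   (forall st st', same_cycle M R st st' -> same_cycle M R st' st) ->
   (forall st1 st2 st3, same_cycle M R st1 st2 -> same_cycle M R st2 st3 ->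
      same_cycle M R st1 st3) ->
   (forall st st', same_cycle M R st st' -> size (build st) = size (build st')) ->
   (forall st, valid l st -> same_cycle M R st (gk l st)) ->
   (forall st, valid l st -> same_cycle M R st (mate l st)) ->
   forall st st', valid l st -> valid l st' -> size (build st) = size (build st') ->
     same_cycle M R st st') ->
  exists s, hamilton_cycle e S s.
Proof.
move=> pM pR sub conn.
have /card_gt0P[x0 x0S] : 0 < #|S| by apply: leq_trans card_levels.
have lsym := linked_sym (proj1 pM) (proj1 pR).
apply: (hamilton_of_matchings (@qadj_odd_weight n) pM pR x0S card_levels) => x xS.
rewrite mem_levels in x0S; rewrite mem_levels in xS.
suff [_ H] : same_cycle M R (dec x0) (dec x).
  by move: H; rewrite size_dec !decK; apply.
apply: conn => //; rewrite ?size_dec //.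
- by move=> st; split=> // _; apply: connect0.
- by move=> st st' [sz H]; split=> // sz'; rewrite /linked lsym; apply: H; rewrite sz.
- move=> st1 st2 st3 [sz1 H1] [sz2 H2]; split; first by rewrite sz1.
  by move=> sz; apply: connect_trans (H1 sz) (H2 _); rewrite -sz1.
- by move=> st st' [].
- move=> st v; have [_ _ /flip_size sz] := gk_spec l_gt0 v; split=> // szn.
  by apply: sub; rewrite -(lift_map_enc _ szn v); apply: linkedR.
- move=> st v; have [_ _ /flip_size sz] := mate_spec l_gt0 v; split=> // szn.
  by apply: sub; rewrite -(lift_map_enc _ szn v); apply: linkedM.
Qed.

(** * The 4-cycles, for l > 1 *)

Definition split_top st :=
  if st is State (C :: Ls) W Rs then
    if unsnode C is Some (A, B) then State (Eps :: B :: A :: Ls) W Rs else st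
  else st.

Definition splittable st :=
  if st is State (C :: Ls) W Rs then
    let s := (size Ls + size Rs)./2 in
    [&& ~~ is_nil C, node_size s Ls Rs & s.+1 < l]
  else false.

(** Recovers [x] from each vertex of [split_set x], so these sets are disjoint. An odd number of
    unmatched 1s marks the chain partners, an empty leading word the split state. *)
Definition unsplit st :=
  let st' := if odd (ones st) then gk_down st else st in
  if st' is State (Eps :: B :: A :: Ls) W Rs then State (snode A B :: Ls) W Rs else st'.

Lemma splittableP st : splittable st -> exists A B Ls W Rs s,
  [/\ st = State (snode A B :: Ls) W Rs, node_size s Ls Rs & s.+1 < l].
Proof.
case: st => [[|C Ls] W Rs] //=; case: (snodeP C) => // A B /and3P[_ ns lt].
by exists A, B, Ls, W, Rs, (size Ls + size Rs)./2.
Qed.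

Lemma flip_split A B Ls W Rs :
  flip (build (State (snode A B :: Ls) W Rs)) (build (State (Eps :: B :: A :: Ls) W Rs)).
Proof.
exists (lbits Ls ++ flat A), true, (flat B ++ false :: false :: flat W ++ rbits Rs).
by rewrite /= flat_snode -?catA /= -?catA.
Qed.

Definition split_set x :=
  [set x; enc n (split_top (dec x)); R0 x; R0 (enc n (split_top (dec x)))].

(** The chain partners of [x] and [u] have the centres A(B) and [Eps] and differ by the bit of
    [flip_snode]; this closes the 4-cycle. *)
Lemma split_facts x : splittable (dec x) ->
  let u := enc n (split_top (dec x)) in
  [/\ x \in S, u \in S, e x u & e (R0 x) (R0 u)] /\
  {in split_set x, forall t, enc n (unsplit (dec t)) = x}.
Proof.
move=> sx u; have [A [B [Ls [W [Rs [s [dE ns lt]]]]]]] := splittableP sx.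
have xE := decK x; have sz := size_dec x.
rewrite /split_set -/u; move: (@erefl _ u); rewrite {1}/u dE /= unsnodeK => uE.
rewrite dE in sz xE; have fl := flip_split A B Ls W Rs; have szu := flip_size fl.
rewrite sz in szu.
have ns2 : node_size s.+1 (B :: A :: Ls) Rs by rewrite node_size2.
have vx := node_valid (snode A B) W ns (ltnW lt).
have vu := node_valid Eps W ns2 lt.
have Rx : R0 x = enc n (State Ls (snode A B) (W :: Rs)).
  by rewrite -xE /R0 lift_map_enc // (gk_node _ _ ns (ltnW lt)).
have Ru : R0 u = enc n (State (B :: A :: Ls) Eps (W :: Rs)).
  by rewrite -uE /R0 lift_map_enc // (gk_node _ _ ns2 lt).
have szR C Ls' : size (build (State Ls' C (W :: Rs))) =
    size (build (State (C :: Ls') W Rs)).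
  by rewrite /= !size_cat /= !size_cat /=; lia.
have [eR oR] : odd (size Rs) = false /\ odd (size Rs).+1.
  by case/and3P: ns => _ /negbTE /= -> _.
split.
  split.
  - by rewrite -xE enc_levels.
  - by rewrite -uE enc_levels.
  - by rewrite -xE -uE; apply: flip_qadj.
  - rewrite Rx Ru; apply: flip_qadj (flip_snode _ _ _ _).
    by rewrite szR.
have xK : unsplit (State (snode A B :: Ls) W Rs) = State (snode A B :: Ls) W Rs.
  by rewrite /unsplit /= eR; have := is_nil_snode A B; case: (snode A B).
have uK : unsplit (State (Eps :: B :: A :: Ls) W Rs) = State (snode A B :: Ls) W Rs.
  by rewrite /unsplit /= eR.
have upK C Ls' : ~~ odd (size Rs) ->
    unsplit (State Ls' C (W :: Rs)) = unsplit (State (C :: Ls') W Rs).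
  by rewrite /unsplit /= => /negbTE ->.
move=> t; rewrite !inE -!orbA => /or4P[]/eqP->.
- by rewrite dE xK.
- by rewrite -uE encK // uK.
- by rewrite Rx encK ?szR // upK ?eR // xK.
- by rewrite Ru encK ?szR // upK ?eR // uK.
Qed.

Lemma hamilton_wide : 1 < l -> exists s, hamilton_cycle e S s.
Proof.
move=> l_gt1.
have [||| | M [R [pM pR sub lk]]] := @iterate_surgery _ e S
    _ (enum [pred x : bitstring n | splittable (dec x)]) M0 R0 split_set
    id (fun x => enc n (split_top (dec x))) (enum_uniq _).
- move=> x; rewrite mem_enum inE => sx; have [[xS uS ex eR] _] := split_facts sx.
  exact: (surgery4 (@qadj_sym n) (@qadj_odd_weight n)).
- move=> x y; rewrite !mem_enum !inE => sx sy; apply: contraNT.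
  case/pred0Pn => t /andP[tx ty]; apply/eqP.
  have [_ Hx] := split_facts sx; have [_ Hy] := split_facts sy.
  by rewrite -(Hx t tx) (Hy t ty).
- exact: perfect_mate.
- exact: perfect_gk.
apply: (hamilton_of_connected pM pR sub) => r sy tr sz g mt.
apply: (connected l_gt0 r sy tr sz g mt l_gt1) => s A B Ls W Rs ns lt.
split; first exact: flip_size (flip_split A B Ls W Rs).
move=> szn; have := lk (enc n (State (snode A B :: Ls) W Rs)).
rewrite mem_enum inE encK //= unsnodeK; apply.
rewrite is_nil_snode /=; case/and3P: (ns) => h1 h2 /eqP h3.
by rewrite h3 doubleK ns.
Qed.

(* The vertices 110u0v0, 101u0v0, 100u1v0, 110u1v0, 111u0v0, 101u1v0, 001u1v0,
   011u1v0, 010u1v0; merging the cycles of the first two realizes the tree move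
   (()u)v ~ ()(u)v. *)
Definition pull_states u v :=
  let w := snode u v in
  [:: State [:: Node (Node Eps u) v] Eps [::];
      State [:: Node Eps (Node u v)] Eps [::];
      State [:: Node Eps Eps] w [::];
      State [::] Eps [:: Node Eps w];
      State [::] Eps [:: Node (Node u v) Eps];
      State [::] (Node Eps Eps) [:: w];
      State [:: Eps; Eps] Eps [:: w];
      State [:: Eps] Eps [:: Eps; w];
      State [:: Eps] (Node Eps w) [::]].

(** The first component tells the nine vertices of a configuration apart; the second recovers u and
    v, which makes different configurations disjoint. *)
Definition pull_key st : nat * option (dyck * dyck) :=
  match st with
  | State [:: Node (Node Eps u) v] Eps [::] => (0, Some (u, v))
  | State [:: Node Eps (Node u v)] Eps [::] => (1, Some (u, v))
  | State [:: Node Eps Eps] w [::] => (2, unsnode w)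
  | State [::] Eps [:: Node Eps w] => (3, unsnode w)
  | State [::] Eps [:: Node (Node u v) Eps] => (4, Some (u, v))
  | State [::] (Node Eps Eps) [:: w] => (5, unsnode w)
  | State [:: Eps; Eps] Eps [:: w] => (6, unsnode w)
  | State [:: Eps] Eps [:: Eps; w] => (7, unsnode w)
  | State [:: Eps] (Node Eps w) [::] => (8, unsnode w)
  | _ => (9, None)
  end.

Definition pullable st :=
  if st is State [:: Node (Node Eps u) v] Eps [::] then true else false.

Definition pull_words st :=
  if (pull_key st).2 is Some uv then uv else (Eps, Eps).

Definition pull_set (x : bitstring n) :=
  let: (u, v) := pull_words (dec x) in
  [set t in [seq enc n st | st <- pull_states u v]].

Lemma pullableP st : pullable st ->
  exists u v, st = State [:: Node (Node Eps u) v] Eps [::].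
Proof.
case: st => -[|[|[|[|? ?] u] v] [|? ?]] [|? ?] [|? ?] //= _.
by exists u, v.
Qed.

Lemma size_pull_states u v st :
  size (build (State [:: Node (Node Eps u) v] Eps [::])) = n ->
  List.In st (pull_states u v) -> size (build st) = n.
Proof.
move=> <- /=; repeat (case=> [<-|]) => //=;
by rewrite ?flat_snode /= ?size_cat /= ?flat_snode /= ?size_cat /= ?flat_snode
     ?size_cat /= ?size_cat /=; lia.
Qed.

Lemma pull_surgery u v : l = 1 ->
  size (build (State [:: Node (Node Eps u) v] Eps [::])) = n ->
  surgery e S M0 R0 [set t in [seq enc n st | st <- pull_states u v]]
    (enc n (State [:: Node (Node Eps u) v] Eps [::]))
    (enc n (State [:: Node Eps (Node u v)] Eps [::])).
Proof.
move=> l1 szn.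
have sz st := size_pull_states szn (st := st).
have va st : List.In st (pull_states u v) -> valid l st.
  by rewrite l1 /=; repeat (case=> [<-|]).
apply: (surgery6 (@qadj_sym n) (@qadj_odd_weight n)).
- apply: (@map_uniq _ _ (fun t => (pull_key (dec t)).1)).
  rewrite /= !encK; try by apply: sz => /=; tauto.
  by [].
- by rewrite /= !enc_levels; try (by apply: sz => /=; tauto);
    rewrite !va //=; tauto.
- by rewrite /M0; split; rewrite lift_map_enc; try (by apply: sz => /=; tauto);
    try (by apply: va => /=; tauto); rewrite l1.
- by rewrite /R0; split; rewrite lift_map_enc; try (by apply: sz => /=; tauto);
    try (by apply: va => /=; tauto); rewrite l1.
split; (apply: flip_qadj; first by apply: sz => /=; tauto).
- exists [:: true, false, true & flat u], true, (flat v ++ [:: false]).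
  by rewrite /= flat_snode -?catA /= -?catA /= ?cats0.
- exists [:: true; true], true, (flat u ++ false :: flat v ++ [:: false]).
  by rewrite /= ?catA /= -?catA /= ?cats0.
- exists [:: true], false, (false :: flat u ++ true :: flat v ++ [:: false]).
  by rewrite /= flat_snode -?catA /= -?catA /= ?cats0.
Qed.

Lemma hamilton_narrow : l = 1 -> exists s, hamilton_cycle e S s.
Proof.
move=> l1.
have pw u v : pull_words (State [:: Node (Node Eps u) v] Eps [::]) = (u, v) by [].
have key x t : pullable (dec x) -> t \in pull_set x ->
    (pull_key (dec t)).2 = Some (pull_words (dec x)).
  case/pullableP=> u [v dE]; have szn := size_dec x; rewrite dE in szn.
  rewrite /pull_set dE pw !inE.
  repeat (case/orP); move/eqP=> ->;
    (rewrite encK; last by apply: (size_pull_states szn) => /=; tauto);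
    by rewrite /= ?unsnodeK.
have [||| | M [R [pM pR sub lk]]] := @iterate_surgery _ e S
    _ (enum [pred x : bitstring n | pullable (dec x)]) M0 R0 pull_set
    id (fun x => let: (u, v) := pull_words (dec x) in
                 enc n (State [:: Node Eps (Node u v)] Eps [::])) (enum_uniq _).
- move=> x; rewrite mem_enum inE => /pullableP[u [v dE]].
  rewrite /pull_set dE pw -{1}[x]decK dE; apply: pull_surgery => //.
  by rewrite -dE size_dec.
- move=> x y; rewrite !mem_enum !inE => sx sy; apply: contraNT.
  case/pred0Pn => t /andP[tx ty]; apply/eqP.
  have := key _ _ sx tx; rewrite (key _ _ sy ty) => -[].
  case/pullableP: sx => u [v dE]; case/pullableP: sy => u' [v' dE'].
  by rewrite dE dE' !pw -[x]decK -[y]decK dE dE' => -[-> ->].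
- exact: perfect_mate.
- exact: perfect_gk.
apply: (hamilton_of_connected pM pR sub) => r sy tr sz g mt.
apply: (connected1 l_gt0 r sy tr sz g mt l1) => u v.
split; first by rewrite /= ?size_cat /= ?size_cat /= ?size_cat /=; lia.
move=> szn; have := lk (enc n (State [:: Node (Node Eps u) v] Eps [::])).
by rewrite mem_enum inE encK //= => /(_ isT).
Qed.

End MiddleLevels.

Unset Implicit Arguments.

Theorem theorem1 (m l : nat) :
  1 <= m -> 1 <= l <= m.+1 ->
  exists c : seq (bitstring (2 * m + 1)),
    hamilton_cycle (@qadj (2 * m + 1)) (levels (2 * m + 1) (m.+1 - l) (m + l)) c.
Proof.
move=> m_gt0 l_bounds; have [l1|l1] := eqVneq l 1.
  exact: hamilton_narrow.
by apply: hamilton_wide => //; lia.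
Qed.
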